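(* Let $\lambda$ be a security parameter and $q=q(\lambda)$ be any polynomial. Let $G=G_{\lambda,q}$ be a pseudorandom function-like state (PRFS) generator with input length $d=d(\lambda,q)$ and output length $n=n(\lambda)$ qubits, and let $\Pi_{\mathsf{SKE}}$ be the secret-key encryption scheme with quantum ciphertexts built from $G$ (defined in the context). Suppose $d\ge 2\log q+1$ and $G$ is a selectively secure PRFS generator. Then $\Pi_{\mathsf{SKE}}$ is CPA-secure for up to $q$ queries.
   Context: QPT means quantum polynomial time; $\log$ is base 2; $x\xleftarrow{R}X$ denotes uniform sampling; $\mathrm{negl}$ denotes a negligible function. PRFS generator. A QPT algorithm $G$ taking a key $k\in\{0,1\}^\lambda$ and an input $x\in\{0,1\}^{d}$ and outputting an $n$-qubit state is a selectively secure PRFS generator if for all polynomials $s=s(\lambda),t=t(\lambda)$, all QPT adversaries $\mathcal{A}$ and every family of distinct indices $(\{x_1,\dots,x_s\}\subseteq\{0,1\}^{d})_\lambda$, $$\Big|\Pr_{k\xleftarrow{R}\{0,1\}^\lambda}[\mathcal{A}(\{x_i,G(k,x_i)^{\otimes t}\}_{i\in[s]})=1]-\Pr_{|\psi_1\rangle,\dots,|\psi_s\rangle\leftarrow\mu_n}[\mathcal{A}(\{x_i,|\psi_i\rangle^{\otimes t}\}_{i\in[s]})=1]\Big|=\mathrm{negl}(\lambda),$$ where $\mu_n$ is the Haar measure on $n$-qubit states. When $n=\omega(\log\lambda)$ there is an efficient algorithm $\mathsf{Test}(k,x,G(k,x'))$ that determines whether $x'=x$ with negligible error. Construction of $\Pi_{\mathsf{SKE}}$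 (message space $\{0,1\}$). - $\mathsf{Gen}(1^\lambda,1^q)$: sample $k_1,\dots,k_\lambda\xleftarrow{R}\{0,1\}^\lambda$; output $\mathsf{sk}=(k_1,\dots,k_\lambda)$. - $\mathsf{Enc}(\mathsf{sk},m)$: sample bits $s_1,\dots,s_\lambda$ uniformly subject to $s_1\oplus\cdots\oplus s_\lambda=m$, and $r_1,\dots,r_\lambda\xleftarrow{R}\{0,1\}^{d-1}$; compute $\rho_i\leftarrow G(k_i,(r_i,s_i))$; output $\{(r_i,\rho_i)\}_{i\in[\lambda]}$. - $\mathsf{Dec}(\mathsf{sk},\{(r_i,\rho_i)\}_i)$: run $\mathsf{Test}(k_i,(r_i,0),\rho_i)$ to obtain $s_i$ for each $i$; output $s_1\oplus\cdots\oplus s_\lambda$. CPA security for up to $q$ queries: in the game with bit $b$, the challenger samples $\mathsf{sk}\leftarrow\mathsf{Gen}(1^\lambda,1^q)$; the adversary adaptively makes at most $q$ queries $(m_0,m_1)$, each answered by $\mathsf{Enc}(\mathsf{sk},m_b)$, and outputs a bit $b'$. Security: $|\Pr[b'=1\mid b=0]-\Pr[b'=1\mid b=1]|=\mathrm{negl}(\lambda)$ for every QPT adversary. *)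

(* Defs.v *)
From HB Require Import structures.
From mathcomp Require Import all_boot all_order all_algebra.
From mathcomp Require Import complex.
From mathcomp Require Import all_classical all_reals all_analysis.

Set Implicit Arguments.
Unset Strict Implicit.
Unset Printing Implicit Defensive.

Import Order.TTheory GRing.Theory Num.Theory.

Local Open Scope ring_scope.
Local Open Scope complex_scope.

(** * Asymptotics *)

Definition poly_bounded (f : nat -> nat) : Prop :=
  exists p : {poly nat}, forall l, (f l <= p.[l]%R)%N.

Definition negligible (R : realType) (f : nat -> R) : Prop :=
  forall c : nat, exists l0, forall l : nat,
    (l0 <= l)%N -> `|f l| <= l%:R ^- c.

(** * Registers of qubits

    A register is a finite type of wires; disjoint union of wire types is the
    tensor product, and ['I_s * W] is a row of [s] copies of the register [W].
    The computational basis of [W] is [bits W], and an operator on [W] is given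
    by its matrix coefficients [rho x y] = <x|rho|y>. *)

Definition bits (W : finType) := {ffun W -> bool}.

Definition op (R : realType) (W : finType) := bits W -> bits W -> R[i].

Definition pull (I W : finType) (f : I -> W) (x : bits W) : bits I :=
  [ffun i => x (f i)].

Definition bcat (I J : finType) (x : bits I) (y : bits J) : bits (I + J)%type :=
  [ffun w => match w with inl i => x i | inr j => y j end].

Definition slot (I W : finType) (x : bits (I * W)%type) (i : I) : bits W :=
  pull (pair i) x.

Definition ketbra (R : realType) (W : finType) (u v : bits W) : op R W :=
  fun x y => ((x == u) && (y == v))%:R.

Definition basis_state (R : realType) (W : finType) (u : bits W) : op R W :=
  ketbra R u u.

Definition tens (R : realType) (I J : finType)
    (rho : op R I) (sigma : op R J) : op R (I + J)%type :=
  fun x y => rho (pull inl x) (pull inl y) * sigma (pull inr x) (pull inr y).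

Definition tens_row (R : realType) (I W : finType)
    (rho : I -> op R W) : op R (I * W)%type :=
  fun x y => \prod_i rho i (slot x i) (slot y i).

(** The tensor product of the linear maps [F i], applied to a possibly
    entangled operator. *)
Definition tens_map (R : realType) (I W V : finType)
    (F : I -> op R W -> op R V) (rho : op R (I * W)%type) :
    op R (I * V)%type :=
  fun x y => \sum_a \sum_b
    rho a b * tens_row (fun i => F i (ketbra R (slot a i) (slot b i))) x y.

(** * Generalized quantum circuits over the gate set {H, T, CNOT} *)

Inductive gate (W : finType) : Type :=
| Hadamard of W
| Tgate of W
| CNOT (c t : W) of c != t.

(** [gate_coef R g x y] = <x|g|y>. *)
Definition gate_coef (R : realType) (W : finType) (g : gate W)
    (x y : bits W) : R[i] :=
  match g with
  | Hadamard w =>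
      if [forall v, (v != w) ==> (x v == y v)]
      then (-1) ^+ (x w && y w) * ((Num.sqrt 2)^-1)%:C else 0
  | Tgate w =>
      if x == y then
        if x w then (Num.sqrt 2)^-1 +i* (Num.sqrt 2)^-1 else 1
      else 0
  | CNOT c t _ =>
      (x == [ffun v => if v == t then y t (+) y c else y v])%:R
  end.

Definition apply_gate (R : realType) (W : finType)
    (rho : op R W) (g : gate W) : op R W :=
  fun x y => \sum_a \sum_b
    gate_coef R g x a * rho a b * (gate_coef R g y b)^*.

(** The wires outside the range of [inw] are initialized to |0>, and those
    outside the range of [outw] are traced out at the end. *)
Record gcircuit (I O : finType) := GCircuit {
  wires : finType;
  inw : I -> wires;
  outw : O -> wires;
  inw_inj : injective inw;
  outw_inj : injective outw;
  gates : seq (gate wires) }.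

Definition csize (I O : finType) (C : gcircuit I O) : nat :=
  (#|wires C| + size (gates C))%N.

Definition init_wires (R : realType) (I W : finType) (f : I -> W)
    (rho : op R I) : op R W :=
  fun x y => rho (pull f x) (pull f y) *
    [forall w, (w \notin codom f) ==> ~~ x w && ~~ y w]%:R.

Definition trace_out (R : realType) (O W : finType) (f : O -> W)
    (sigma : op R W) : op R O :=
  fun x y => \sum_(a | pull f a == x)
    \sum_(b | (pull f b == y) &&
              [forall w, (w \notin codom f) ==> (a w == b w)]) sigma a b.

Definition channel (R : realType) (I O : finType) (C : gcircuit I O)
    (rho : op R I) : op R O :=
  trace_out (@outw _ _ C)
    (foldl (@apply_gate R (wires C)) (init_wires (@inw _ _ C) rho) (gates C)).

(** The probability that measuring the output qubit yields 1. *)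
Definition accept (R : realType) (I : finType) (C : gcircuit I unit)
    (rho : op R I) : R :=
  complex.Re (channel C rho [ffun => true] [ffun => true]).

(** Quantum polynomial time is non-uniform: families of circuits of polynomial
    size. *)
Definition qpt (I O : nat -> finType)
    (C : forall l, gcircuit (I l) (O l)) : Prop :=
  poly_bounded (fun l => csize (C l)).

(** * Haar measure on pure states *)

(** A vector of C^(2^n), stored as the real and imaginary parts of its
    amplitudes so as to carry the Borel sigma-algebra of the library. *)
Definition qvec (R : realType) (n : nat) :=
  #|bits 'I_n|.-tuple (R * R)%type.

HB.instance Definition _ (R : realType) (n : nat) :=
  Measurable.on (qvec R n).

Definition amplitudes (R : realType) (n : nat) (psi : qvec R n) :
    'cV[R[i]]_#|bits 'I_n| :=
  \col_j ((tnth psi j).1 +i* (tnth psi j).2).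

Definition qvec_of (R : realType) (n : nat) (v : 'cV[R[i]]_#|bits 'I_n|) :
    qvec R n :=
  [tuple (complex.Re (v j 0), complex.Im (v j 0)) | j < #|bits 'I_n|].

Definition pure (R : realType) (n : nat) (psi : qvec R n) : op R 'I_n :=
  fun x y => amplitudes psi (enum_rank x) 0 *
             (amplitudes psi (enum_rank y) 0)^*.

(** The unitarily invariant probability measure on the unit sphere. *)
Definition is_haar (R : realType) (n : nat) (mu : probability (qvec R n) R) :
    Prop :=
  mu [set psi : qvec R n | \sum_j `|amplitudes psi j 0| ^+ 2 = 1]%classic = 1%E
  /\ forall U : 'M[R[i]]_#|bits 'I_n|, U \is unitarymx ->
     forall A : set (qvec R n), measurable A ->
       mu [set psi : qvec R n | A (qvec_of (U *m amplitudes psi))]%classic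
       = mu A.

Section iid.
Context {dT : measure_display} {T : measurableType dT} {R : realType}.

Section cons_law.
Variables (s : nat) (P : probability T R) (Q : probability (s.-tuple T) R).

Definition cons_law : set (s.+1.-tuple T) -> \bar R :=
  pushforward (P \x Q)%E (fun x : T * s.-tuple T => [tuple of x.1 :: x.2]).

Let measurable_cons_pair :
  measurable_fun setT (fun x : T * s.-tuple T => [tuple of x.1 :: x.2]).
Proof. by apply: measurable_cons. Qed.

Let cons_law0 : cons_law set0 = 0%E.
Proof. by rewrite /cons_law /pushforward preimage_set0 measure0. Qed.

Let cons_law_ge0 A : (0 <= cons_law A)%E.
Proof. exact: measure_ge0. Qed.

Let cons_law_sigma_additive : semi_sigma_additive cons_law.
Proof.
move=> F mF tF mUF; rewrite /cons_law /pushforward preimage_bigcup.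
apply: measure_semi_sigma_additive.
- by move=> i; rewrite -[X in measurable X]setTI; exact: measurable_cons_pair.
- apply/trivIsetP => /= i j _ _ ij; rewrite -preimage_setI.
  by move/trivIsetP : tF => /(_ _ _ _ _ ij) ->//; rewrite preimage_set0.
- rewrite -preimage_bigcup -[X in measurable X]setTI.
  exact: measurable_cons_pair.
Qed.

HB.instance Definition _ := isMeasure.Build _ _ _ cons_law
  cons_law0 cons_law_ge0 cons_law_sigma_additive.

Let cons_lawT : cons_law setT = 1%E.
Proof.
rewrite /cons_law /pushforward preimage_setT -setXTT product_measure1E//.
transitivity (1 * 1 : \bar R)%E; last by rewrite mule1.
by congr (_ * _)%E; exact: probability_setT.
Qed.

HB.instance Definition _ :=
  Measure_isProbability.Build _ _ _ cons_law cons_lawT.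

End cons_law.

(** The law of [s] independent samples from [P]. *)
Fixpoint iid (P : probability T R) (s : nat) : probability (s.-tuple T) R :=
  match s with
  | 0 => \d_[tuple]
  | s'.+1 => cons_law P (iid P s')
  end.

End iid.

(** * Pseudorandom function-like states *)

(** G(k, x) *)
Definition prfs_eval (R : realType) (l d n : nat)
    (G : gcircuit ('I_l + 'I_d)%type 'I_n) (k : bits 'I_l) (x : bits 'I_d) :
    op R 'I_n :=
  channel G (basis_state R (bcat k x)).

(** [prfs_view t x rho] is {x_i, rho_i^(⊗ t)}_i. *)
Definition prfs_view (R : realType) (d n s t : nat)
    (x : 'I_s -> bits 'I_d) (rho : 'I_s -> op R 'I_n) :
    op R ('I_s * ('I_d + 'I_t * 'I_n))%type :=
  tens_row (fun i =>
    tens (basis_state R (x i)) (tens_row (fun _ : 'I_t => rho i))).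

Definition prfs_real (R : realType) (l d n s t : nat)
    (G : gcircuit ('I_l + 'I_d)%type 'I_n) (x : 'I_s -> bits 'I_d)
    (A : gcircuit ('I_s * ('I_d + 'I_t * 'I_n))%type unit) : R :=
  #|bits 'I_l|%:R^-1 *
  \sum_(k : bits 'I_l) accept A (prfs_view x (fun i => prfs_eval R G k (x i))).

Definition prfs_ideal (R : realType) (d n s t : nat)
    (mu : probability (qvec R n) R) (x : 'I_s -> bits 'I_d)
    (A : gcircuit ('I_s * ('I_d + 'I_t * 'I_n))%type unit) : R :=
  \int[iid mu s]_(psi in setT)
    accept A (prfs_view x (fun i => pure (tnth psi i))).

Definition selectively_secure_prfs (R : realType)
    (mu : forall m, probability (qvec R m) R) (d n : nat -> nat)
    (G : forall l, gcircuit ('I_l + 'I_(d l))%type 'I_(n l)) : Prop :=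
  qpt G /\
  forall s t : nat -> nat, poly_bounded s -> poly_bounded t ->
  forall A : (forall l,
    gcircuit ('I_(s l) * ('I_(d l) + 'I_(t l) * 'I_(n l)))%type unit),
  qpt A ->
  forall x : (forall l, 'I_(s l) -> bits 'I_(d l)),
  (forall l, injective (x l)) ->
  negligible (fun l =>
    prfs_real R (G l) (x l) (A l) - prfs_ideal (mu (n l)) (x l) (A l)).

(** * Secret-key encryption of bits with quantum ciphertexts *)

(** [gen sk] is the probability of the key [sk]; [dec sk rho m] is the
    probability that decrypting [rho] under [sk] yields [m]. *)
Record ske (R : realType) := SKE {
  skey : finType;
  cipher : finType;
  gen : skey -> R;
  enc : skey -> bool -> op R cipher;
  dec : skey -> op R cipher -> bool -> R }.

(** An adaptive adversary holding the quantum memory [M]: it either outputs a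
    bit, or prepares two message bits (on the wires [false] and [true], for
    m_0 and m_1) along with a new memory, and continues once given the
    ciphertext. *)
Inductive cpa_adv (ct : finType) : finType -> Type :=
| Output (M : finType) of gcircuit M unit : cpa_adv ct M
| Query (M M' : finType) of gcircuit M (bool + M')%type &
    cpa_adv ct (ct + M')%type : cpa_adv ct M.

Fixpoint queries (ct M : finType) (A : cpa_adv ct M) : nat :=
  match A with
  | Output _ _ => 0
  | Query _ _ _ A' => (queries A').+1
  end.

Fixpoint adv_size (ct M : finType) (A : cpa_adv ct M) : nat :=
  match A with
  | Output _ C => csize C
  | Query _ _ C A' => (csize C + adv_size A')%N
  end.

(** The unnormalized memory state after measuring the messages to be [m]. *)
Definition measured (R : realType) (M : finType) (m : bits bool)
    (sigma : op R (bool + M)%type) : op R M :=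
  fun x y => sigma (bcat m x) (bcat m y).

(** The probability that the adversary outputs 1, for the encryption oracle
    [E m_0 m_1]. *)
Fixpoint cpa_run (R : realType) (ct M : finType)
    (E : bool -> bool -> op R ct) (A : cpa_adv ct M) : op R M -> R :=
  match A with
  | Output _ C => fun rho => accept C rho
  | Query _ _ C A' => fun rho =>
      \sum_(m : bits bool) cpa_run E A'
        (tens (E (m false) (m true)) (measured m (channel C rho)))
  end.

(** Pr[b' = 1 | b]. The adversary starts with an empty memory. *)
Definition cpa_game (R : realType) (S : ske R)
    (A : cpa_adv (cipher S) void) (b : bool) : R :=
  \sum_(sk : skey S) gen sk *
    cpa_run (fun m0 m1 => enc sk (if b then m1 else m0)) A
      (basis_state R [ffun=> false]).

(** [S l q] is the scheme with key generation Gen(1^l, 1^q). *)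
Definition cpa_secure (R : realType) (S : nat -> nat -> ske R)
    (q : nat -> nat) : Prop :=
  forall A : (forall l, cpa_adv (cipher (S l (q l))) void),
  (forall l, (queries (A l) <= q l)%N) ->
  poly_bounded (fun l => adv_size (A l)) ->
  negligible (fun l => cpa_game (A l) false - cpa_game (A l) true).

(** * The scheme *)

(** The [d]-bit string (r, b). *)
Definition bsnoc (d : nat) (r : bits 'I_d.-1) (b : bool) : bits 'I_d :=
  [ffun j => if insub (val j) is Some j' then r j' else b].

Definition parity (l : nat) (s : bits 'I_l) : bool := \big[addb/false]_i s i.

Section scheme.
Variables (R : realType) (l d n : nat).
Variable G : gcircuit ('I_l + 'I_d)%type 'I_n.
(** [Test] takes a key, an input and a state, and outputs 1 for a match. *)
Variable Test : gcircuit ('I_l + 'I_d + 'I_n)%type unit.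

Let key := {ffun 'I_l -> bits 'I_l}.
Let coins := {ffun 'I_l -> bits 'I_d.-1}.
Let ct : finType := ('I_l * ('I_d.-1 + 'I_n))%type.

Definition prfs_gen (sk : key) : R := #|{: key}|%:R^-1.

Definition prfs_enc (sk : key) (m : bool) : op R ct := fun x y =>
  #|[set s : bits 'I_l | parity s == m]|%:R^-1 * #|{: coins}|%:R^-1 *
  \sum_(s : bits 'I_l | parity s == m) \sum_(r : coins)
    tens_row (fun i =>
      tens (basis_state R (r i))
        (prfs_eval R G (sk i) (bsnoc (r i) (s i)))) x y.

(** The unnormalized state of the registers rho_i after measuring the classical
    parts of the ciphertext to be [r]. *)
Definition cipher_slice (r : coins) (rho : op R ct) :
    op R ('I_l * 'I_n)%type :=
  let mix (a : bits ('I_l * 'I_n)%type) : bits ct :=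
    [ffun p => match p.2 with inl j => r p.1 j | inr w => a (p.1, w) end] in
  fun a b => rho (mix a) (mix b).

(** The outcome of the [i]-th test being [t (i, tt)], one has
    s_i = ~~ t (i, tt), since the test is against the input (r_i, 0). *)
Definition prfs_dec (sk : key) (rho : op R ct) (m : bool) : R :=
  \sum_(r : coins)
  \sum_(t : bits ('I_l * unit)%type |
          parity [ffun i => ~~ t (i, tt)] == m)
    complex.Re (tens_map (fun i sigma =>
        channel Test
          (tens (basis_state R (bcat (sk i) (bsnoc (r i) false))) sigma))
      (cipher_slice r rho) t t).

Definition ske_of_prfs : ske R :=
  {| skey := key; cipher := ct;
     gen := prfs_gen; enc := prfs_enc; dec := prfs_dec |}.

End scheme.

(* Main.v *)
Require Import Defs.
From mathcomp Require Import all_boot all_order all_algebra.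
From mathcomp Require Import complex.
From mathcomp Require Import all_classical all_reals all_analysis.
From mathcomp Require Import ring lra zify.

Set Implicit Arguments.
Unset Strict Implicit.
Unset Printing Implicit Defensive.

Import Order.TTheory GRing.Theory Num.Theory.

Local Open Scope ring_scope.

(** Fix all the coins r of the encryption oracle. As 2^(d-1) >= q^2, for each of
    the l keys the q strings r collide with probability at most 1/2, so with
    probability at least 1 - 2^-l there is an index i0 whose inputs
    (r_i0, s_i0) are pairwise distinct over the queries, whatever the bits s_i0.
    Choose any i1 <> i0; each query is answered by drawing uniformly all the s_i
    with i <> i1 and setting s_i1 to the message xored with all of them. The
    experiment is then a non-uniform distinguisher that receives only the states
    G(k_i0, (r_i0, s_i0)) and computes everything else from hard-wired strings.
    It does not look at the inputs of the generator, so its acceptance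
    probability on Haar random states does not depend on them, and selective
    security, used twice, allows replacing every (r_i0, s_i0) by (r_i0, 0).
    After that s_i0 is a one-time pad on s_i1, and the oracle is independent of
    the message. *)

(** * Wires *)

(** Selective security fixes the inputs before the challenge, whereas the messages are chosen
    adaptively. Hence the message must not reach block i0: the bit that depends on it is s_i1, and
    the reduction holds the key of i1. Circuits consist of gates only and cannot branch on a
    measured message, so the correction of s_i1 is a CNOT from the message wire onto the last input
    wire of the generator at i1, after which the message wires are traced out.

    Hard-wiring coins and pads is legitimate because a run is multilinear in the answers of the
    oracle: randomness refreshed at each query can be drawn before the run. Linearity over complex
    coefficients is the reason why [cpa_amp] is complex-valued.

    Every l has many such distinguishers, one for each choice of strings, while security provides a
    threshold that depends on the family; it is applied to a family of worst choices. On coins that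
    collide at every index only the bound 1 is available, and obtaining it takes positivity and
    trace preservation of circuits. *)

Definition splice (I W : finType) (f : I -> W) (x : bits I) (a : bits W) :
    bits W :=
  [ffun w => if [pick i | f i == w] is Some i then x i else a w].

(** The identity relation on the wires that a gate moved along [f] leaves alone; with [pull f] it
    splits a basis string into two independent coordinates. *)
Definition agree (I W : finType) (f : I -> W) (x y : bits W) : bool :=
  [forall w, (w \notin codom f) ==> (x w == y w)].

Definition zeros (I W : finType) (f : I -> W) (x : bits W) : bool :=
  [forall w, (w \notin codom f) ==> ~~ x w].

Section wires.
Variables (I W : finType) (f : I -> W).
Hypothesis finj : injective f.
Implicit Types (x : bits I) (a b : bits W).

Lemma splice_in x a i : splice f x a (f i) = x i.
Proof.
rewrite ffunE; case: pickP => [j /eqP /finj -> // | /(_ i)].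
by rewrite eqxx.
Qed.

Lemma splice_notin x a w : w \notin codom f -> splice f x a w = a w.
Proof.
move=> wf; rewrite ffunE; case: pickP => // j /eqP fj.
by rewrite -fj codom_f in wf.
Qed.

Lemma pull_splice x a : pull f (splice f x a) = x.
Proof. by apply/ffunP => i; rewrite ffunE splice_in. Qed.

Lemma wireP (P : W -> Prop) :
  (forall i, P (f i)) -> (forall w, w \notin codom f -> P w) -> forall w, P w.
Proof.
move=> Pf Pn w; have [/codomP[i ->]|] := boolP (w \in codom f); first exact: Pf.
exact: Pn.
Qed.

Lemma splice_splice x x' a : splice f x (splice f x' a) = splice f x a.
Proof.
apply/ffunP; elim/wireP => [i | w wf]; first by rewrite !splice_in.
by rewrite !splice_notin.
Qed.

Lemma splice_pull a b : agree f a b -> splice f (pull f a) b = a.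
Proof.
move=> /forallP ab; apply/ffunP; elim/wireP => [i | w wf].
  by rewrite splice_in ffunE.
by rewrite splice_notin //; have /implyP/(_ wf)/eqP -> := ab w.
Qed.

Lemma agree_splice x a : agree f (splice f x a) a.
Proof. by apply/forallP => w; apply/implyP => wf; rewrite splice_notin. Qed.

Lemma agree_sym a b : agree f a b = agree f b a.
Proof. by apply: eq_forallb => w; rewrite eq_sym. Qed.

Lemma agree_refl a : agree f a a.
Proof. by apply/forallP => w; rewrite eqxx implybT. Qed.

Lemma eq_agree a b : (a == b) = (pull f a == pull f b) && agree f a b.
Proof.
apply/eqP/andP => [-> | [/eqP ab a_b]]; first by rewrite eqxx agree_refl.
by rewrite -(splice_pull a_b) ab splice_pull // agree_refl.
Qed.

Lemma zeros_splice x a : zeros f (splice f x a) = zeros f a.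
Proof.
apply: eq_forallb => w; have [wf|//] := boolP (w \notin codom f).
by rewrite splice_notin.
Qed.

Lemma sum_agree (C : pzSemiRingType) (F : bits W -> C) a :
  \sum_b F b * (agree f a b)%:R = \sum_x F (splice f x a).
Proof.
under eq_bigr do rewrite mulr_natr mulrb.
rewrite -big_mkcond /=.
rewrite (reindex_onto (fun x => splice f x a) (fun b => pull f b)) /=; last first.
  by move=> b ab; rewrite splice_pull // agree_sym.
apply: eq_bigl => x.
by rewrite pull_splice eqxx andbT agree_sym agree_splice.
Qed.

(** Overwriting the range of [f] is a bijection between two fibres of [pull f], so any fibre may
    serve to enumerate the traced wires. *)
Lemma sum_splice_swap (C : nmodType) (F : bits W -> C) x x' :
  \sum_(a | pull f a == x) F (splice f x' a) = \sum_(a | pull f a == x') F a.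
Proof.
rewrite [RHS](reindex_onto (splice f x') (splice f x)) /=; last first.
  by move=> a /eqP <-; rewrite splice_splice splice_pull // agree_refl.
apply: eq_bigl => a; rewrite pull_splice eqxx splice_splice /=.
apply/eqP/eqP => [<- | <-]; last by rewrite pull_splice.
by rewrite splice_pull // agree_refl.
Qed.

End wires.

(** * Gates, initialization and partial trace under relabelling of wires *)

Section circuits.
Variable R : realType.

(** The column index has no freedom: [y] fixes it on the range of [f], and the partial trace fixes
    it elsewhere. *)
Lemma trace_outE (I W : finType) (f : I -> W) (sigma : op R W) x y :
  injective f ->
  trace_out f sigma x y = \sum_(a | pull f a == x) sigma a (splice f y a).
Proof.
move=> finj; apply: eq_bigr => a _.
rewrite (big_pred1 (splice f y a)) // => b /=.
rewrite -/(agree f a b); apply/andP/eqP => [[/eqP <- ab] | ->].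
  by rewrite splice_pull // agree_sym.
by rewrite pull_splice // eqxx agree_sym agree_splice.
Qed.

Lemma init_wiresE (I W : finType) (f : I -> W) (rho : op R I) x y :
  init_wires f rho x y =
  rho (pull f x) (pull f y) * (zeros f x)%:R * (zeros f y)%:R.
Proof.
rewrite /init_wires -mulrA -natrM mulnb; congr (_ * _%:R); congr nat_of_bool.
apply/forallP/andP => [h | [/forallP hx /forallP hy] w].
  by split; apply/forallP => w; have := h w;
    case: (w \notin codom f) => //= /andP[].
by have := hx w; have := hy w; case: (w \notin codom f) => //= -> ->.
Qed.

Lemma opP (W : finType) (rho sigma : op R W) :
  (forall x y, rho x y = sigma x y) -> rho = sigma.
Proof. by move=> e; apply/funext => x; apply/funext => y. Qed.

Section map_gate.
Variables (I W : finType) (f : I -> W).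
Hypothesis finj : injective f.

Lemma pullE (x : bits W) i : pull f x i = x (f i).
Proof. by rewrite ffunE. Qed.

Lemma map_gate_subproof (c t : I) : c != t -> f c != f t.
Proof. by apply: contra => /eqP/finj ->. Qed.

Definition map_gate (g : gate I) : gate W :=
  match g with
  | Hadamard w => Hadamard (f w)
  | Tgate w => Tgate (f w)
  | CNOT c t ct => CNOT (map_gate_subproof ct)
  end.

(** A relabelled gate is the original one tensored with the identity, and [agree] is the matrix of
    that identity. *)
Lemma gate_coef_map g (x y : bits W) :
  gate_coef R (map_gate g) x y =
  gate_coef R g (pull f x) (pull f y) * (agree f x y)%:R.
Proof.
case: g => [w | w | c t ct] /=.
- rewrite !pullE.
  have -> : [forall v, (v != f w) ==> (x v == y v)] =
      [forall v, (v != w) ==> (pull f x v == pull f y v)] && agree f x y.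
    apply/forallP/andP => [h | [/forallP h /forallP xy]].
      split; apply/forallP => v; apply/implyP => vw.
        rewrite !pullE; apply: (implyP (h (f v))).
        by apply: contra vw => /eqP/finj ->.
      by apply: (implyP (h v)); apply: contraNneq vw => ->; exact: codom_f.
    elim/(wireP (f := f)) => [i | v vf]; apply/implyP => vw.
      have := implyP (h i); rewrite !pullE; apply.
      by apply: contra vw => /eqP ->.
    exact: (implyP (xy v)).
  by case: (agree f x y); rewrite ?andbT ?andbF ?mulr1 ?mulr0.
- rewrite (eq_agree finj) !pullE.
  by case: (agree f x y); rewrite ?andbT ?andbF ?mulr1 ?mulr0.
- rewrite -natrM mulnb (eq_agree finj); congr (_%:R); congr nat_of_bool.
  congr (_ && _).
    congr (_ == _); apply/ffunP => v; by rewrite !ffunE (inj_eq finj).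
  apply: eq_forallb => w; have [wf|//] := boolP (w \notin codom f).
  by rewrite ffunE ifN //; apply: contraNneq wf => ->; exact: codom_f.
Qed.

Lemma apply_map_gateE (rho : op R W) g x y :
  apply_gate rho (map_gate g) x y =
  \sum_a \sum_b gate_coef R g (pull f x) a * rho (splice f a x) (splice f b y)
    * (gate_coef R g (pull f y) b)^*.
Proof.
rewrite /apply_gate.
transitivity (\sum_a (\sum_b gate_coef R g (pull f x) (pull f a) *
    rho a (splice f b y) * (gate_coef R g (pull f y) b)^*) * (agree f x a)%:R).
  apply: eq_bigr => a _; rewrite big_distrl /=.
  transitivity (\sum_b (gate_coef R g (pull f x) (pull f a) * rho a b *
      (gate_coef R g (pull f y) (pull f b))^* * (agree f x a)%:R) *
      (agree f y b)%:R).
    apply: eq_bigr => b _; rewrite !gate_coef_map rmorphM /= conjC_nat.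
    by ring.
  by rewrite sum_agree //; apply: eq_bigr => b _; rewrite pull_splice.
by rewrite sum_agree //; apply: eq_bigr => a _; rewrite pull_splice.
Qed.

Lemma init_wires_gate (rho : op R I) g :
  init_wires f (apply_gate rho g) = apply_gate (init_wires f rho) (map_gate g).
Proof.
apply: opP => x y; rewrite apply_map_gateE init_wiresE /apply_gate !big_distrl.
apply: eq_bigr => a _; rewrite !big_distrl; apply: eq_bigr => b _ /=.
rewrite init_wiresE !pull_splice // !zeros_splice //; ring.
Qed.

(** Like [init_wires_gate], this moves gates across another operation, so that a composed circuit
    returns to the form: initialize, apply gates, trace out. *)
Lemma trace_out_gate (rho : op R W) g :
  trace_out f (apply_gate rho (map_gate g)) = apply_gate (trace_out f rho) g.
Proof.
apply: opP => x y; rewrite trace_outE //.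
transitivity (\sum_(a | pull f a == x) \sum_c \sum_d
    gate_coef R g x c * rho (splice f c a) (splice f d (splice f c a)) *
      (gate_coef R g y d)^*).
  apply: eq_bigr => a /eqP ax; rewrite apply_map_gateE ax.
  apply: eq_bigr => c _; apply: eq_bigr => d _.
  by rewrite pull_splice // !splice_splice.
rewrite exchange_big; apply: eq_bigr => c _ /=.
rewrite exchange_big; apply: eq_bigr => d _ /=.
rewrite -big_distrl -big_distrr /= trace_outE //; congr (_ * _ * _).
exact: (sum_splice_swap finj (fun e => rho e (splice f d e))).
Qed.

End map_gate.

Lemma trace_out_comp (I J W : finType) (f : I -> J) (g : J -> W)
    (rho : op R W) : injective f -> injective g ->
  trace_out (g \o f) rho = trace_out f (trace_out g rho).
Proof.
move=> fi gi; have gfi : injective (g \o f) by exact: inj_comp.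
apply: opP => x y; rewrite !trace_outE //.
have pgf (a : bits W) : pull (g \o f) a = pull f (pull g a).
  by apply/ffunP => i; rewrite !ffunE.
rewrite (partition_big (pull g) (fun e => pull f e == x)) /=; last first.
  by move=> a; rewrite pgf.
apply: eq_bigr => e /eqP ex; rewrite trace_outE //.
apply: eq_big => [a | a /andP[_ /eqP ae]].
  by rewrite pgf; apply: andb_idl => /eqP ->; rewrite ex.
congr (rho _ _); apply/ffunP; elim/(wireP (f := g)) => [j|w wg].
  rewrite splice_in //; move: j; elim/(wireP (f := f)) => [i|j jf].
    by rewrite -[g (f i)]/((g \o f) i) !splice_in.
  rewrite !splice_notin // -?ae ?ffunE //.
  by apply/codomP => -[i /= /gi ji]; rewrite ji codom_f in jf.
rewrite !splice_notin //; apply: contra wg => /codomP[i ->]; exact: codom_f.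
Qed.

Lemma init_wires_comp (I J W : finType) (f : I -> J) (g : J -> W)
    (rho : op R I) : injective g ->
  init_wires (g \o f) rho = init_wires g (init_wires f rho).
Proof.
move=> gi; apply: opP => x y; rewrite !init_wiresE.
have pgf (a : bits W) : pull (g \o f) a = pull f (pull g a).
  by apply/ffunP => i; rewrite !ffunE.
have zgf (a : bits W) : zeros (g \o f) a = zeros f (pull g a) && zeros g a.
  apply/forallP/andP => [h|[/forallP hf /forallP hg]].
    split; apply/forallP => v; apply/implyP => vf; last first.
      apply: (implyP (h v)); apply: contra vf => /codomP[i ->].
      exact: codom_f.
    rewrite ffunE; apply: (implyP (h _)).
    by apply: contra vf => /codomP[i /gi ->]; exact: codom_f.
  elim/(wireP (f := g)) => [j|w wg]; last by rewrite (implyP (hg w)) ?implybT.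
  apply/implyP => jf; have := implyP (hf j); rewrite ffunE; apply.
  by apply: contra jf => /codomP[i ->]; exact: (codom_f (g \o f)).
rewrite !zgf !pgf -!mulnb !natrM; ring.
Qed.

End circuits.

(** * Circuit transformations *)

Section linearity.
Variable R : realType.

(** Coins, pads and measured messages all enter as such combinations and leave a channel by
    linearity. *)
Definition op_sum (W : finType) (T : finType) (c : T -> R[i])
    (rho : T -> op R W) : op R W :=
  fun x y => \sum_i c i * rho i x y.

Lemma apply_gate_sum (W T : finType) (c : T -> R[i]) (rho : T -> op R W) g :
  apply_gate (op_sum c rho) g = op_sum c (fun i => apply_gate (rho i) g).
Proof.
apply: opP => x y; rewrite /apply_gate /op_sum.
under [RHS]eq_bigr do rewrite big_distrr.
rewrite [RHS]exchange_big; apply: eq_bigr => a _.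
under [RHS]eq_bigr do rewrite big_distrr.
rewrite [RHS]exchange_big; apply: eq_bigr => b _ /=.
rewrite big_distrr big_distrl; apply: eq_bigr => i _ /=; ring.
Qed.

Lemma apply_gates_sum (W T : finType) (c : T -> R[i]) (rho : T -> op R W) gs :
  foldl (@apply_gate R W) (op_sum c rho) gs =
  op_sum c (fun i => foldl (@apply_gate R W) (rho i) gs).
Proof.
by elim: gs rho => //= g gs IH rho; rewrite apply_gate_sum IH.
Qed.

Lemma init_wires_sum (I W T : finType) (f : I -> W) (c : T -> R[i])
    (rho : T -> op R I) :
  init_wires f (op_sum c rho) = op_sum c (fun i => init_wires f (rho i)).
Proof.
apply: opP => x y; rewrite /init_wires /op_sum big_distrl.
by apply: eq_bigr => i _; rewrite mulrA.
Qed.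

Lemma trace_out_sum (O W T : finType) (f : O -> W) (c : T -> R[i])
    (rho : T -> op R W) :
  trace_out f (op_sum c rho) = op_sum c (fun i => trace_out f (rho i)).
Proof.
apply: opP => x y; rewrite /trace_out /op_sum.
under [RHS]eq_bigr do rewrite big_distrr.
rewrite [RHS]exchange_big; apply: eq_bigr => a _.
under [RHS]eq_bigr do rewrite big_distrr.
by rewrite [RHS]exchange_big.
Qed.

Lemma channel_sum (I O T : finType) (C : gcircuit I O) (c : T -> R[i])
    (rho : T -> op R I) :
  channel C (op_sum c rho) = op_sum c (fun i => channel C (rho i)).
Proof. by rewrite /channel init_wires_sum apply_gates_sum trace_out_sum. Qed.

End linearity.

(** * Gates, fresh wires and discarded wires in front of a circuit *)

Section prefix.
Variable R : realType.

Lemma init_wires_gates (I W : finType) (f : I -> W) (finj : injective f)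
    (rho : op R I) gs :
  init_wires f (foldl (@apply_gate R I) rho gs) =
  foldl (@apply_gate R W) (init_wires f rho) (map (map_gate finj) gs).
Proof.
by elim: gs rho => //= g gs IH rho; rewrite IH (init_wires_gate finj).
Qed.

Lemma trace_out_gates (I W : finType) (f : I -> W) (finj : injective f)
    (rho : op R W) gs :
  trace_out f (foldl (@apply_gate R W) rho (map (map_gate finj) gs)) =
  foldl (@apply_gate R I) (trace_out f rho) gs.
Proof.
by elim: gs rho => //= g gs IH rho; rewrite IH (trace_out_gate finj).
Qed.

Definition pre_gates (I O : finType) (gs : seq (gate I)) (C : gcircuit I O) :
    gcircuit I O :=
  GCircuit (@inw_inj _ _ C) (@outw_inj _ _ C)
    (map (map_gate (@inw_inj _ _ C)) gs ++ gates C).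

Lemma channel_pre_gates (I O : finType) gs (C : gcircuit I O) (rho : op R I) :
  channel (pre_gates gs C) rho = channel C (foldl (@apply_gate R I) rho gs).
Proof. by rewrite /channel /= foldl_cat -init_wires_gates. Qed.

Lemma csize_pre_gates (I O : finType) gs (C : gcircuit I O) :
  csize (pre_gates gs C) = (size gs + csize C)%N.
Proof. by rewrite /csize /= size_cat size_map addnCA. Qed.

(** No gate is added: a wire of [J] outside the range of [f] is no longer an input of [C], and
    therefore starts at |0>. *)
Definition pre_init (I J O : finType) (f : I -> J) (finj : injective f)
    (C : gcircuit J O) : gcircuit I O :=
  GCircuit (inj_comp (@inw_inj _ _ C) finj) (@outw_inj _ _ C) (gates C).

Lemma channel_pre_init (I J O : finType) (f : I -> J) (finj : injective f)
    (C : gcircuit J O) (rho : op R I) :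
  channel (pre_init finj C) rho = channel C (init_wires f rho).
Proof. by rewrite /channel /= init_wires_comp //; exact: inw_inj. Qed.

Lemma csize_pre_init (I J O : finType) (f : I -> J) (finj : injective f)
    (C : gcircuit J O) : csize (pre_init finj C) = csize C.
Proof. by []. Qed.

Section pre_trace.
Variables (I J O : finType) (f : J -> I) (finj : injective f).
Variable C : gcircuit J O.

Definition traced := {i : I | i \notin codom f}.

(** This lives in [Type] and carries its witness, since [trace_inw] computes with the preimage. *)
Variant codom_spec (i : I) : Type :=
| InCodom j of f j = i
| NotInCodom of i \notin codom f.

Lemma codomS i : codom_spec i.
Proof.
have [h|h] := boolP (i \in codom f); last exact: NotInCodom h.
exact: InCodom (f_iinv h).
Qed.

(** A discarded input still needs a place: it gets a wire of its own on the right, which no gate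
    touches and which is not an output, so that it is traced out at the end. *)
Definition trace_inw (i : I) : (wires C + traced)%type :=
  match codomS i with
  | InCodom j _ => inl (inw C j)
  | NotInCodom h => inr (exist _ i h)
  end.

Lemma trace_inw_in j : trace_inw (f j) = inl (inw C j).
Proof.
rewrite /trace_inw; case: codomS => [j' /finj -> //|h].
by have := h; rewrite codom_f.
Qed.

Lemma trace_inw_notin (u : traced) : trace_inw (val u) = inr u.
Proof.
rewrite /trace_inw; case: codomS => [j ju|h].
  by have := valP u; rewrite /= -ju codom_f.
by congr inr; apply: val_inj.
Qed.

Lemma tracedP (P : I -> Prop) :
  (forall j, P (f j)) -> (forall u : traced, P (val u)) -> forall i, P i.
Proof.
move=> Pf Pn; elim/(wireP (f := f)) => // w wf.
exact: (Pn (exist _ w wf)).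
Qed.

Lemma trace_inw_inj : injective trace_inw.
Proof.
elim/tracedP => [j | u]; elim/tracedP => [j' | u'];
  rewrite ?trace_inw_in ?trace_inw_notin //.
  by case=> /(@inw_inj _ _ C) ->.
by case=> ->.
Qed.

Definition pre_trace : gcircuit I O :=
  GCircuit trace_inw_inj (inj_comp (@inl_inj _ traced) (@outw_inj _ _ C))
    (map (map_gate (@inl_inj _ traced)) (gates C)).

Lemma trace_out_trace_inw (rho : op R I) :
  trace_out inl (init_wires trace_inw rho) =
  init_wires (inw C) (trace_out f rho).
Proof.
have inlN (w : wires C) : (inl w \notin codom trace_inw) = (w \notin codom (inw C)).
  congr negb; apply/codomP/codomP => [[]|[j ->]]; last first.
    by exists (f j); rewrite trace_inw_in.
  elim/tracedP => [j|u]; rewrite ?trace_inw_in ?trace_inw_notin // => -[->].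
  by exists j.
have inrN u : (inr u \notin codom trace_inw) = false.
  by rewrite -trace_inw_notin codom_f.
have zeroE (a : bits (wires C + traced)%type) :
    zeros trace_inw a = zeros (inw C) (pull inl a).
  apply/forallP/forallP => h.
    by move=> w; have := h (inl w); rewrite inlN ffunE.
  by case=> [w|u]; [have := h w; rewrite inlN ffunE | rewrite inrN].
apply: opP => x y; rewrite trace_outE; last exact: inl_inj.
rewrite init_wiresE trace_outE // !big_distrl.
rewrite [RHS](reindex_onto (pull trace_inw)
  (fun e => bcat x [ffun u : traced => e (val u)])) /=; last first.
  move=> e /eqP ex; apply/ffunP; elim/tracedP => [j|u].
    by rewrite ffunE trace_inw_in ffunE -(pullE (inw C)) -ex ffunE.
  by rewrite ffunE trace_inw_notin !ffunE.
apply: eq_big => [a | a /eqP ax].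
  apply/eqP/andP => [<-|[_ /eqP <-]]; last first.
    by apply/ffunP => w; rewrite !ffunE.
  split; apply/eqP/ffunP; first by move=> j; rewrite !ffunE trace_inw_in.
  by case=> [w|u]; rewrite !ffunE // trace_inw_notin.
rewrite init_wiresE !zeroE ax pull_splice; last exact: inl_inj.
congr (rho _ _ * _ * _); apply/ffunP; elim/tracedP => [j|u].
  rewrite splice_in // !pullE trace_inw_in splice_in //; exact: inl_inj.
rewrite splice_notin ?(valP u) // !pullE trace_inw_notin splice_notin //.
by apply/codomP => -[].
Qed.

Lemma channel_pre_trace (rho : op R I) :
  channel pre_trace rho = channel C (trace_out f rho).
Proof.
rewrite /channel /= trace_out_comp; [|exact: outw_inj|exact: inl_inj].
by rewrite trace_out_gates trace_out_trace_inw.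
Qed.

Lemma csize_pre_trace : csize pre_trace = (csize C + (#|I| - #|J|))%N.
Proof.
rewrite /csize /= card_sum size_map addnAC; congr (_ + _)%N.
rewrite card_sig -(card_codom finj).
by rewrite -[#|I|](cardC [in codom f]) addKn; exact: eq_card.
Qed.

End pre_trace.

End prefix.

(** * Running a circuit on part of a register *)

Definition idr (K I W : finType) (f : I -> W) (z : (K + I)%type) :
    (K + W)%type :=
  match z with inl k => inl k | inr i => inr (f i) end.

Lemma idr_inj (K I W : finType) (f : I -> W) :
  injective f -> injective (@idr K I W f).
Proof. by move=> finj [k|i] [k'|i'] //= [] => [->|/finj ->]. Qed.

Lemma pull_bcatl (I J : finType) (x : bits I) (y : bits J) :
  pull inl (bcat x y) = x.
Proof. by apply/ffunP => i; rewrite !ffunE. Qed.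

Lemma pull_bcatr (I J : finType) (x : bits I) (y : bits J) :
  pull inr (bcat x y) = y.
Proof. by apply/ffunP => i; rewrite !ffunE. Qed.

Lemma bcat_pull (I J : finType) (x : bits (I + J)%type) :
  bcat (pull inl x) (pull inr x) = x.
Proof. by apply/ffunP => -[i|i]; rewrite !ffunE. Qed.

Section right_factor.
Variables (R : realType) (K I W : finType) (f : I -> W).
Hypothesis finj : injective f.
Variable kappa : op R K.

Lemma init_wires_idr (rho : op R I) :
  init_wires (@idr K _ _ f) (tens kappa rho) = tens kappa (init_wires f rho).
Proof.
have zeroE (x : bits (K + W)%type) : zeros (@idr K _ _ f) x = zeros f (pull inr x).
  have idrN w : (inr w \notin codom (@idr K _ _ f)) = (w \notin codom f).
    congr negb; apply/codomP/codomP => [[[k|i]] //= [->] | [i ->]].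
      by exists i.
    by exists (inr i).
  apply/forallP/forallP => h.
    by move=> w; have := h (inr w); rewrite idrN ffunE.
  case=> [k|w]; last by have := h w; rewrite idrN ffunE.
  by apply/implyP => /negP[]; exact: (codom_f (@idr K _ _ f) (inl k)).
apply: opP => x y; rewrite /tens !init_wiresE !zeroE -!mulrA.
by congr (kappa _ _ * (rho _ _ * _)); apply/ffunP => i; rewrite !ffunE.
Qed.

Lemma trace_out_idr (sigma : op R W) :
  trace_out (@idr K _ _ f) (tens kappa sigma) = tens kappa (trace_out f sigma).
Proof.
apply: opP => x y; rewrite trace_outE; last exact: idr_inj.
rewrite /tens trace_outE // big_distrr /=.
rewrite (reindex_onto (bcat (pull inl x)) (pull inr)) /=; last first.
  move=> a /eqP ax; rewrite -[RHS]bcat_pull; congr bcat.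
  by apply/ffunP => k; rewrite -ax !ffunE.
apply: eq_big => [a | a /andP[/eqP ax _]].
  rewrite pull_bcatr eqxx andbT; apply/eqP/eqP => [<-|ax].
    by apply/ffunP => i; rewrite !ffunE.
  apply/ffunP => -[k|i]; rewrite !ffunE /= ?ffunE //.
  by have := congr1 (fun z : bits I => z i) ax; rewrite !ffunE.
have idrI := idr_inj (K := K) finj.
rewrite pull_bcatl pull_bcatr; congr (kappa _ _ * sigma _ _).
  by apply/ffunP => k; rewrite pullE -[inl k]/(@idr K _ _ f (inl k)) splice_in // ffunE.
apply/ffunP; elim/(wireP (f := f)) => [i|w wf].
  by rewrite pullE -[inr (f i)]/(@idr K _ _ f (inr i)) !splice_in // ffunE.
rewrite pullE !splice_notin // ?ffunE //.
by apply: contra wf => /codomP[[k|i] //= [->]]; exact: codom_f.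
Qed.

End right_factor.

Lemma apply_gate_tensr (R : realType) (K I : finType) (kappa : op R K)
    (rho : op R I) g :
  apply_gate (tens kappa rho) (map_gate (@inr_inj K I) g) =
  tens kappa (apply_gate rho g).
Proof.
apply: opP => x y; rewrite apply_map_gateE /tens big_distrr.
apply: eq_bigr => a _; rewrite big_distrr; apply: eq_bigr => b _ /=.
have pl (z : bits (K + I)%type) (c : bits I) : pull inl (splice inr c z) = pull inl z.
  apply/ffunP => k; rewrite !pullE splice_notin //.
  by apply/codomP => -[].
rewrite !pl !pull_splice; try exact: inr_inj.
ring.
Qed.

Lemma apply_gates_tensr (R : realType) (K I : finType) (kappa : op R K)
    (rho : op R I) gs :
  foldl (@apply_gate R _) (tens kappa rho) (map (map_gate (@inr_inj K I)) gs) =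
  tens kappa (foldl (@apply_gate R _) rho gs).
Proof. by elim: gs rho => //= g gs IH rho; rewrite apply_gate_tensr IH. Qed.

(** [K] holds what waits while [C] runs, such as the challenge states of later queries. These stay
    in a product with the memory, so [channel_pre_circuit] treats product operators only. *)
Definition pre_circuit (K I O Z : finType) (C : gcircuit I O)
    (D : gcircuit (K + O)%type Z) : gcircuit (K + I)%type Z :=
  pre_init (idr_inj (@inw_inj _ _ C))
    (pre_gates (map (map_gate (@inr_inj K (wires C))) (gates C))
      (pre_trace (idr_inj (@outw_inj _ _ C)) D)).

Lemma channel_pre_circuit (R : realType) (K I O Z : finType) (C : gcircuit I O)
    (D : gcircuit (K + O)%type Z) (kappa : op R K) (rho : op R I) :
  channel (pre_circuit C D) (tens kappa rho) =
  channel D (tens kappa (channel C rho)).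
Proof.
rewrite channel_pre_init channel_pre_gates channel_pre_trace.
rewrite init_wires_idr ?apply_gates_tensr ?trace_out_idr //.
exact: outw_inj.
Qed.

Lemma csize_pre_circuit (K I O Z : finType) (C : gcircuit I O)
    (D : gcircuit (K + O)%type Z) :
  (csize (pre_circuit C D) <= csize C + csize D)%N.
Proof.
rewrite csize_pre_init csize_pre_gates csize_pre_trace size_map !card_sum /csize.
by rewrite subnDl [leqRHS]addnAC [leqRHS]addnC leq_add2l [leqRHS]addnC leq_add2l
  leq_subr.
Qed.

(** * One circuit applied to every slot of a row *)

Section row.
Variables (R : realType) (L I W : finType) (f : I -> W).
Hypothesis finj : injective f.

Definition idp (p : (L * I)%type) : (L * W)%type := (p.1, f p.2).

Lemma idp_inj : injective idp.
Proof. by move=> [i w] [j v] [-> /finj ->]. Qed.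

Lemma codom_idp i w : ((i, w) \in codom idp) = (w \in codom f).
Proof.
apply/codomP/codomP => [[[j v] [_ ->]]|[v ->]]; first by exists v.
by exists (i, v).
Qed.

Lemma slot_pull (x : bits (L * W)%type) i : slot (pull idp x) i = pull f (slot x i).
Proof. by apply/ffunP => v; rewrite !ffunE. Qed.

Lemma slot_splice (x : bits (L * I)%type) (a : bits (L * W)%type) i :
  slot (splice idp x a) i = splice f (slot x i) (slot a i).
Proof.
apply/ffunP; elim/(wireP (f := f)) => [v|w wf].
  rewrite pullE -[(i, f v)]/(idp (i, v)) !splice_in // ?pullE //.
  exact: idp_inj.
rewrite pullE !splice_notin // ?pullE ?codom_idp //; exact: idp_inj.
Qed.

Lemma init_wires_idp (rho : L -> op R I) :
  init_wires idp (tens_row rho) = tens_row (fun i => init_wires f (rho i)).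
Proof.
have zeroE (x : bits (L * W)%type) :
    (zeros idp x)%:R = \prod_i (zeros f (slot x i))%:R :> R[i].
  have -> : zeros idp x = [forall i, zeros f (slot x i)].
    apply/forallP/forallP => h.
      move=> i; apply/forallP => w; have := h (i, w).
      by rewrite codom_idp pullE.
    by case=> i w; rewrite codom_idp; have /forallP/(_ w) := h i; rewrite pullE.
  have [/forallP h|] := boolP [forall i, zeros f (slot x i)].
    by rewrite big1 // => i _; rewrite h.
  rewrite negb_forall => /existsP[i /negbTE hi].
  by rewrite (bigD1 i) //= hi mul0r.
apply: opP => x y; rewrite init_wiresE !zeroE /tens_row -!big_split.
by apply: eq_bigr => i _ /=; rewrite init_wiresE !slot_pull.
Qed.

Lemma trace_out_idp (rho : L -> op R W) :
  trace_out idp (tens_row rho) = tens_row (fun i => trace_out f (rho i)).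
Proof.
apply: opP => x y; rewrite trace_outE; last exact: idp_inj.
rewrite /tens_row; under [RHS]eq_bigr do rewrite trace_outE //.
rewrite bigA_distr_big_dep /=.
(* Distributing the product over the sums yields families of strings on [W], which are the same as
   strings on [L * W]. *)
rewrite (reindex_onto (fun h : {ffun L -> bits W} =>
    [ffun p => h p.1 p.2] : bits (L * W)%type)
  (fun a => [ffun i => slot a i])) /=; last first.
  by move=> a _; apply/ffunP => -[i w]; rewrite !ffunE.
have slotE (h : {ffun L -> bits W}) i :
    slot ([ffun p => h p.1 p.2] : bits (L * W)%type) i = h i.
  by apply/ffunP => w; rewrite !ffunE.
apply: eq_big => [h|h _]; last first.
  by apply: eq_bigr => i _; rewrite slot_splice slotE.
have -> : [ffun i => slot ([ffun p => h p.1 p.2] : bits (L * W)%type) i] == h.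
  by apply/eqP/ffunP => i; rewrite ffunE slotE.
rewrite andbT; apply/eqP/familyP => [<- i|hx].
  by rewrite unfold_in slot_pull slotE.
apply/ffunP => -[i v]; have := hx i; rewrite unfold_in => /eqP/ffunP/(_ v).
by rewrite !ffunE.
Qed.

End row.

Lemma pair_inj (L W : finType) (i : L) : injective (@pair L W i).
Proof. by move=> v w []. Qed.

Lemma apply_gate_row (R : realType) (L W : finType) (rho : L -> op R W) i g :
  apply_gate (tens_row rho) (map_gate (@pair_inj L W i) g) =
  tens_row (fun j => if j == i then apply_gate (rho i) g else rho j).
Proof.
apply: opP => x y; rewrite apply_map_gateE /tens_row (bigD1 i) //= eqxx.
have so (c : bits W) (z : bits (L * W)%type) j :
    slot (splice (pair i) c z) j = if j == i then c else slot z j.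
  apply/ffunP => w; rewrite pullE; case: eqP => [->|/eqP ji].
    by rewrite splice_in //; exact: pair_inj.
  rewrite splice_notin ?pullE //.
  by apply/codomP => -[v [] /eqP]; rewrite (negbTE ji).
rewrite big_distrl; apply: eq_bigr => a _ /=.
rewrite big_distrl; apply: eq_bigr => b _ /=.
rewrite (bigD1 i) //= !so !eqxx.
rewrite !mulrA [RHS]mulrAC; congr (_ * _ * _).
by apply: eq_bigr => j ji; rewrite !so (negbTE ji).
Qed.

Section row_circuit.
Variables (L I O : finType) (C : gcircuit I O).

Definition row_gates (s : seq L) : seq (gate (L * wires C)%type) :=
  flatten [seq map (map_gate (@pair_inj L (wires C) i)) (gates C) | i <- s].

Definition row_circuit : gcircuit (L * I)%type (L * O)%type :=
  GCircuit (idp_inj (@inw_inj _ _ C)) (idp_inj (@outw_inj _ _ C))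
    (row_gates (enum L)).

(** Gates on distinct slots do not interfere; [uniq] ensures that [C] runs once per slot. *)
Lemma apply_row_gates (R : realType) (rho : L -> op R (wires C)) s : uniq s ->
  foldl (@apply_gate R _) (tens_row rho) (row_gates s) =
  tens_row (fun i => if i \in s then foldl (@apply_gate R _) (rho i) (gates C)
                     else rho i).
Proof.
have one (i : L) gs rho' :
    foldl (@apply_gate R _) (tens_row rho')
      (map (map_gate (@pair_inj L (wires C) i)) gs) =
    tens_row (fun j => if j == i then foldl (@apply_gate R _) (rho' i) gs
                       else rho' j).
  elim: gs rho' => [|g gs IH] rho' /=.
    by congr tens_row; apply/funext => j; case: eqP => [->|].
  rewrite apply_gate_row IH eqxx; congr tens_row; apply/funext => j.
  by case: eqP.
elim: s rho => [|i s IH] rho //= /andP[iNs us].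
rewrite /row_gates /= foldl_cat -/(row_gates s) one IH //.
congr tens_row; apply/funext => j; rewrite inE.
by case: eqP => [->|] //=; rewrite (negbTE iNs).
Qed.

Lemma channel_row_circuit (R : realType) (rho : L -> op R I) :
  channel row_circuit (tens_row rho) = tens_row (fun i => channel C (rho i)).
Proof.
rewrite /channel /= init_wires_idp apply_row_gates ?enum_uniq //.
rewrite trace_out_idp; last exact: outw_inj.
by congr tens_row; apply/funext => i; rewrite mem_enum.
Qed.

Lemma csize_row_circuit : csize row_circuit = (#|L| * csize C)%N.
Proof.
rewrite /csize /= card_prod mulnDr; congr (_ + _)%N.
rewrite /row_gates size_flatten /shape -map_comp sumnE big_map.
rewrite (eq_bigr (fun _ => size (gates C))); last by move=> i _ /=; rewrite size_map.
by rewrite big_enum sum_nat_const.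
Qed.

End row_circuit.

(** * Operators as sums of dyads *)

Section dyads.
Variables (R : realType) (W : finType).

(** A gate acts on such a sum vector by vector. Taking [w = v] gives the positive operators, and
    letting [w] differ reaches all operators. *)
Definition dyads (E : finType) (v w : E -> bits W -> R[i]) : op R W :=
  fun x y => \sum_e v e x * (w e y)^*.

Definition gate_vec (v : bits W -> R[i]) (g : gate W) : bits W -> R[i] :=
  fun x => \sum_a gate_coef R g x a * v a.

Definition gates_vec (gs : seq (gate W)) (v : bits W -> R[i]) :=
  foldl gate_vec v gs.

Lemma apply_gates_dyads (E : finType) (v w : E -> bits W -> R[i]) gs :
  foldl (@apply_gate R W) (dyads v w) gs =
  dyads (gates_vec gs \o v) (gates_vec gs \o w).
Proof.
elim: gs v w => [|g gs IH] v w //=.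
rewrite -[RHS](IH (fun e => gate_vec (v e) g) (fun e => gate_vec (w e) g)).
congr foldl; apply: opP => x y; rewrite /apply_gate /dyads /gate_vec.
under [RHS]eq_bigr do rewrite big_distrl /=.
rewrite [RHS]exchange_big /=; apply: eq_bigr => a _.
under [RHS]eq_bigr do rewrite rmorph_sum big_distrr /=.
rewrite [RHS]exchange_big /=; apply: eq_bigr => b _.
rewrite big_distrr big_distrl; apply: eq_bigr => e _ /=.
by rewrite rmorphM /=; ring.
Qed.

(** The decomposition into matrix units; it extends what is proved for vectors to arbitrary
    operators. *)
Lemma op_dyads (rho : op R W) :
  rho = dyads (fun e : bits W * bits W => fun x => rho e.1 e.2 * (x == e.1)%:R)
              (fun e => fun y => (y == e.2)%:R).
Proof.
apply: opP => x y; rewrite /dyads (bigD1 (x, y)) //= !eqxx conjC_nat !mulr1.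
rewrite big1 ?addr0 // => -[a b]; rewrite xpair_eqE negb_and /= conjC_nat.
rewrite [x == a]eq_sym [y == b]eq_sym.
by case/orP => /negbTE ->; rewrite ?mulr0 ?mul0r.
Qed.

End dyads.

(** * Preparing basis states *)

Section flips.
Variable W : finType.

Definition setbit (w : W) (p : bool) (x : bits W) : bits W :=
  [ffun v => if v == w then p else x v].

Definition xor_bit (w : W) (p : bool) (x : bits W) : bits W :=
  [ffun v => if v == w then x v (+) p else x v].

Lemma xor_bitK (w : W) p : involutive (xor_bit w p).
Proof.
by move=> x; apply/ffunP => k; rewrite !ffunE; case: eqP; rewrite ?addbK.
Qed.

(* Z = T^4 and X = H Z H. *)
Definition not_gates (w : W) : seq (gate W) :=
  [:: Hadamard w; Tgate w; Tgate w; Tgate w; Tgate w; Hadamard w].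

Variable R : realType.
Implicit Types (v : bits W -> R[i]).

Lemma hadamard_vec v w x :
  gate_vec v (Hadamard w) x =
  (real_complex R (Num.sqrt 2)^-1) *
    (v (setbit w false x) + (-1) ^+ x w * v (setbit w true x)).
Proof.
have ft : setbit w false x != setbit w true x.
  by apply/eqP => /ffunP/(_ w); rewrite !ffunE eqxx.
have same p : [forall u, (u != w) ==> (x u == setbit w p x u)].
  by apply/forallP => u; apply/implyP => uw; rewrite ffunE (negbTE uw).
rewrite /gate_vec (bigD1 (setbit w false x)) //=.
rewrite (bigD1 (setbit w true x)) /=; last by rewrite eq_sym.
rewrite big1 ?addr0 => [|a /andP[af aT]].
  rewrite !same !ffunE eqxx andbF andbT expr0; ring.
rewrite ifN ?mul0r //; apply/negP => /forallP h.
have : a = setbit w (a w) x.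
  apply/ffunP => u; rewrite ffunE; case: eqP => [->|/eqP uw] //.
  by have /implyP/(_ uw)/eqP := h u.
by case: (a w) => /eqP; apply/negP.
Qed.

Lemma tgate_vec v w x :
  gate_vec v (Tgate w) x =
  (if x w then (complex.Complex (Num.sqrt 2)^-1 (Num.sqrt 2)^-1) else 1) * v x.
Proof.
rewrite /gate_vec (bigD1 x) //= eqxx big1 ?addr0 // => a.
by rewrite eq_sym => /negbTE ->; rewrite mul0r.
Qed.

(** The amplitude after H T^4 H at a string with a 1 on the flipped wire, [a] and [b] being the old
    amplitudes with 1 and 0 there. The two hypotheses are all that is used about h = 1/sqrt 2 and t
    = e^(i pi/4). *)
Lemma not_true (F : comPzRingType) (h t a b : F) :
  h * h * 2 = 1 -> t ^+ 4 = -1 ->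
  h * (1 * (1 * (1 * (1 * (h * (b + (-1) ^+ 0 * a))))) +
    (-1) ^+ 1 * (t * (t * (t * (t * (h * (b + (-1) ^+ 1 * a))))))) = b.
Proof.
move=> h2 ht; transitivity (h * h * (b + a - t ^+ 4 * (b - a))); first by ring.
by rewrite ht -[RHS]mul1r -[in RHS]h2; ring.
Qed.

Lemma not_false (F : comPzRingType) (h t a b : F) :
  h * h * 2 = 1 -> t ^+ 4 = -1 ->
  h * (1 * (1 * (1 * (1 * (h * (b + (-1) ^+ 0 * a))))) +
    (-1) ^+ 0 * (t * (t * (t * (t * (h * (b + (-1) ^+ 1 * a))))))) = a.
Proof.
move=> h2 ht; transitivity (h * h * (b + a + t ^+ 4 * (b - a))); first by ring.
by rewrite ht -[RHS]mul1r -[in RHS]h2; ring.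
Qed.

Lemma half_sqrt2 :
  real_complex R (Num.sqrt 2)^-1 * real_complex R (Num.sqrt 2)^-1 * 2 = 1.
Proof.
rewrite -rmorphM /= -expr2 exprVn sqr_sqrtr //.
by rewrite fmorphV rmorph_nat mulVf // pnatr_eq0.
Qed.

Lemma not_gates_vec w v : gates_vec (not_gates w) v = v \o xor_bit w true.
Proof.
apply/funext => x.
have ht : (complex.Complex (Num.sqrt 2)^-1 (Num.sqrt 2)^-1 : R[i]) ^+ 4 = -1.
  have ss : (Num.sqrt 2)^-1 * (Num.sqrt 2)^-1 = 2^-1 :> R.
    by rewrite -expr2 exprVn sqr_sqrtr.
  (* Here t = e^(i pi/4), so t^2 = i. *)
  have t2 : (complex.Complex (Num.sqrt 2)^-1 (Num.sqrt 2)^-1 : R[i]) ^+ 2 =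
      complex.Complex 0 1.
    by apply/eqP; rewrite expr2 eq_complex /= ss; apply/andP; split; apply/eqP; lra.
  rewrite (exprM _ 2 2) t2; apply/eqP; rewrite expr2 eq_complex /=.
  by apply/andP; split; apply/eqP; lra.
have w2 p q : setbit w p (setbit w q x) = setbit w p x.
  by apply/ffunP => u; rewrite !ffunE; case: eqP.
rewrite /gates_vec /= hadamard_vec !tgate_vec !hadamard_vec !w2 !ffunE eqxx.
have -> : xor_bit w true x = setbit w (~~ x w) x.
  by apply/ffunP => u; rewrite !ffunE; case: eqP => [->|]; rewrite ?addbT.
move: (complex.Complex _ _ : R[i]) ht => t ht.
move: (real_complex R _) half_sqrt2 => h h2.
case: (x w) => /=; move: (v (setbit w true x)) (v (setbit w false x)) => a b.
  exact (@not_true R[i]%C h t a b h2 ht).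
exact (@not_false R[i]%C h t a b h2 ht).
Qed.

Lemma apply_not_gates w (rho : op R W) :
  foldl (@apply_gate R W) rho (not_gates w) =
  fun x y => rho (xor_bit w true x) (xor_bit w true y).
Proof.
rewrite [in LHS](op_dyads rho) apply_gates_dyads [in RHS](op_dyads rho).
by rewrite (funext (not_gates_vec w)).
Qed.

Lemma apply_nots s (rho : op R W) : uniq s ->
  foldl (@apply_gate R W) rho (flatten (map not_gates s)) =
  fun x y => rho [ffun w => x w (+) (w \in s)] [ffun w => y w (+) (w \in s)].
Proof.
elim: s rho => [|w s IH] rho.
  by move=> _; apply: opP => x y; congr (rho _ _); apply/ffunP => w;
    rewrite ffunE in_nil addbF.
move=> /andP[ws us]; have -> : flatten (map not_gates (w :: s)) =
    not_gates w ++ flatten (map not_gates s) by [].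
rewrite foldl_cat IH // apply_not_gates; apply: opP => x y.
by congr (rho _ _); apply/ffunP => u; rewrite !ffunE inE; case: eqP => [->|] //=;
  rewrite (negbTE ws) addbF.
Qed.

End flips.

(** Strings are hard-wired by negating fresh |0> wires. A negation takes six gates, whence the
    factor 6 in the sizes below. *)
Definition pre_basis (K I Z : finType) (u : bits I)
    (D : gcircuit (K + I)%type Z) : gcircuit K Z :=
  pre_init (@inl_inj K I)
    (pre_gates (flatten (map (@not_gates (K + I)%type)
       (map inr (enum [pred i | u i])))) D).

Lemma channel_pre_basis (R : realType) (K I Z : finType) (u : bits I)
    (D : gcircuit (K + I)%type Z) (rho : op R K) :
  channel (pre_basis u D) rho = channel D (tens rho (basis_state R u)).
Proof.
rewrite channel_pre_init channel_pre_gates apply_nots; last first.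
  by rewrite map_inj_uniq ?enum_uniq //; exact: inr_inj.
congr channel; apply: opP => x y; rewrite init_wiresE /tens /basis_state /ketbra.
set ux := [ffun w => x w (+) _]; set uy := [ffun w => y w (+) _].
have pl (z : bits (K + I)%type) :
    pull inl [ffun w => z w (+) (w \in map inr (enum [pred i | u i]))] = pull inl z.
  apply/ffunP => k; rewrite !ffunE; case: mapP => [[] //|_].
  by rewrite addbF.
have zr (z : bits (K + I)%type) :
    zeros inl [ffun w => z w (+) (w \in map inr (enum [pred i | u i]))] =
    (pull inr z == u).
  have inrE i : (inr i \in map (@inr K I) (enum [pred i | u i])) = u i.
    by rewrite mem_map ?mem_enum //; exact: inr_inj.
  apply/forallP/eqP => [h|zu].
    apply/ffunP => i; have /implyP := h (inr i).
    rewrite !ffunE inrE => hi.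
    have : ~~ (z (inr i) (+) u i) by apply: hi; apply/negP => /codomP[].
    by case: (z (inr i)); case: (u i).
  case=> [k|i]; first by rewrite codom_f.
  by rewrite ffunE inrE -zu ffunE addbb implybT.
by rewrite !pl !zr -mulnb natrM mulrA.
Qed.

Lemma csize_pre_basis (K I Z : finType) (u : bits I)
    (D : gcircuit (K + I)%type Z) :
  (csize (pre_basis u D) <= 6 * #|I| + csize D)%N.
Proof.
rewrite csize_pre_init csize_pre_gates leq_add2r size_flatten /shape -map_comp.
rewrite sumnE big_map (eq_bigr (fun=> 6%N)) //.
rewrite big_const_seq iter_addn_0 leq_mul2l /= count_predT size_map -cardE.
exact: max_card.
Qed.

(** * Measuring one wire into a fresh one *)

Section measure.
Variables (R : realType) (K M U : finType) (b : bool) (w : U).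

Lemma cnot_coef (W : finType) (c t : W) (ct : c != t) (x a : bits W) :
  gate_coef R (CNOT ct) x a = (a == xor_bit t (x c) x)%:R.
Proof.
rewrite /=; congr (_%:R); congr nat_of_bool; apply/eqP/eqP => ->; apply/ffunP => v;
  rewrite !ffunE (negbTE ct); case: eqP => // ->; by rewrite ?ffunE ?eqxx ?addbK.
Qed.

Lemma apply_CNOT (W : finType) (c t : W) (ct : c != t) (rho : op R W) :
  apply_gate rho (CNOT ct) =
  fun x y => rho (xor_bit t (x c) x) (xor_bit t (y c) y).
Proof.
apply: opP => x y; rewrite /apply_gate.
under eq_bigr do under eq_bigr do rewrite !cnot_coef.
rewrite (bigD1 (xor_bit t (x c) x)) //= (bigD1 (xor_bit t (y c) y)) //=.
rewrite [X in _ + X]big1; last first.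
  by move=> a /negbTE ax; rewrite big1 // => e _; rewrite ax !mul0r.
rewrite [X in _ + X + _]big1; last first.
  by move=> a /negbTE ax; rewrite ax conjC0 mulr0.
by rewrite !eqxx conjC1 mul1r mulr1 !addr0.
Qed.

Definition copy_gate : gate ((K + (bool + M)) + U)%type :=
  @CNOT _ (inl (inr (inl b))) (inr w) isT.

Definition keep (z : ((K + M) + U)%type) : ((K + (bool + M)) + U)%type :=
  match z with
  | inl (inl k) => inl (inl k)
  | inl (inr m) => inl (inr (inr m))
  | inr u => inr u
  end.

Lemma keep_inj : injective keep.
Proof. by move=> [[k|m]|u] [[k'|m']|u'] //= [->]. Qed.

(** Deferred measurement: tracing out the message wires forces the row and column messages to
    coincide, which is the effect of measuring them, while the CNOT has already added m_b to the
    wire [w]. *)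
Lemma measure_copy (kappa : op R K) (sigma : op R (bool + M)%type) u :
  trace_out keep
    (apply_gate (tens (tens kappa sigma) (basis_state R u)) copy_gate) =
  op_sum (fun=> 1) (fun m : bits bool =>
    tens (tens kappa (measured m sigma)) (basis_state R (xor_bit w (m b) u))).
Proof.
apply: opP => x y; rewrite apply_CNOT trace_outE; last exact: keep_inj.
pose put m (z : bits ((K + M) + U)%type) : bits ((K + (bool + M)) + U)%type :=
  bcat (bcat (pull inl (pull inl z)) (bcat m (pull inr (pull inl z)))) (pull inr z).
pose msg (a : bits ((K + (bool + M)) + U)%type) : bits bool :=
  pull inl (pull inr (pull inl a)).
have msgK m z : msg (put m z) = m.
  by rewrite /msg /put pull_bcatl pull_bcatr pull_bcatl.
rewrite (reindex_onto (put^~ x) msg) /=; last first.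
  move=> a /eqP <-; apply/ffunP => -[[k|[c|m]]|v]; by rewrite !ffunE.
apply: eq_big => [m|m _].
  rewrite msgK eqxx andbT; apply/eqP/ffunP => -[[k|m']|v]; by rewrite pullE /= !ffunE.
have -> : splice keep y (put m x) = put m y.
  apply/ffunP => z; have keepI := keep_inj.
  case: z => [[k|[c|m']]|v].
  - by have /= -> := splice_in keepI y (put m x) (inl (inl k)); rewrite !ffunE.
  - rewrite splice_notin; last by apply/codomP => -[[[k|m'']|v]] /=.
    by rewrite !ffunE.
  - by have /= -> := splice_in keepI y (put m x) (inl (inr m')); rewrite !ffunE.
  - by have /= -> := splice_in keepI y (put m x) (inr v); rewrite !ffunE.
rewrite mul1r /tens /measured /basis_state /ketbra.
have pl z : pull inl (xor_bit (inr w) (put m z (inl (inr (inl b)))) (put m z)) =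
    bcat (pull inl (pull inl z)) (bcat m (pull inr (pull inl z))).
  by apply/ffunP => v; rewrite !ffunE.
have pr z : (pull inr (xor_bit (inr w) (put m z (inl (inr (inl b)))) (put m z)) == u)
    = (pull inr z == xor_bit w (m b) u).
  have -> : pull inr (xor_bit (inr w) (put m z (inl (inr (inl b)))) (put m z)) =
      xor_bit w (m b) (pull inr z).
    by apply/ffunP => v; rewrite !ffunE.
  apply/eqP/eqP => [<-|->]; apply/ffunP => v; rewrite !ffunE; case: eqP => //.
    by rewrite addbK.
  by rewrite addbK.
by rewrite !pl !pr !pull_bcatl !pull_bcatr.
Qed.

End measure.

(** * Runs of an adversary against a sequence of oracles *)

Section runs.
Variables (R : realType) (ct : finType) (b : bool).

(** The real part is not taken yet, which keeps linearity over complex coefficients. *)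
Definition one_amp (I : finType) (C : gcircuit I unit) (rho : op R I) : R[i] :=
  channel C rho [ffun=> true] [ffun=> true].

(** [Es j] answers the [j]-th query, and is given [m_b] only. *)
Fixpoint cpa_amp (M : finType) (A : cpa_adv ct M) :
    ('I_(queries A) -> bool -> op R ct) -> op R M -> R[i] :=
  match A in cpa_adv _ M
    return ('I_(queries A) -> bool -> op R ct) -> op R M -> R[i] with
  | Output _ C => fun _ rho => one_amp C rho
  | Query _ _ C A' => fun Es rho =>
      \sum_(m : bits bool) @cpa_amp _ A' (fun j => Es (lift ord0 j))
        (tens (Es ord0 (m b)) (measured m (channel C rho)))
  end.

Lemma cpa_runE (E : bool -> op R ct) (M : finType) (A : cpa_adv ct M) rho :
  cpa_run (fun m0 m1 => E (if b then m1 else m0)) A rho =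
  complex.Re (cpa_amp (A := A) (fun=> E) rho).
Proof.
elim: A rho => [M' C|M0 M' C A IH] rho //=.
rewrite raddf_sum; apply: eq_bigr => m _ /=; rewrite IH.
by congr (complex.Re (cpa_amp _ (tens (E _) _))); case: b.
Qed.

Lemma tens_suml (I J T : finType) (c : T -> R[i]) (rho : T -> op R I)
    (sigma : op R J) :
  tens (op_sum c rho) sigma = op_sum c (fun i => tens (rho i) sigma).
Proof.
apply: opP => x y; rewrite /tens /op_sum big_distrl.
by apply: eq_bigr => i _; rewrite mulrA.
Qed.

Lemma tens_sumr (I J T : finType) (c : T -> R[i]) (rho : op R I)
    (sigma : T -> op R J) :
  tens rho (op_sum c sigma) = op_sum c (fun i => tens rho (sigma i)).
Proof.
apply: opP => x y; rewrite /tens /op_sum big_distrr.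
by apply: eq_bigr => i _; rewrite mulrCA.
Qed.

Lemma measured_sum (M T : finType) m (c : T -> R[i])
    (rho : T -> op R (bool + M)%type) :
  measured m (op_sum c rho) = op_sum c (fun i => measured m (rho i)).
Proof. by []. Qed.

Lemma one_amp_sum (I T : finType) (C : gcircuit I unit) (c : T -> R[i])
    (rho : T -> op R I) :
  one_amp C (op_sum c rho) = \sum_i c i * one_amp C (rho i).
Proof. by rewrite /one_amp channel_sum. Qed.

Lemma cpa_amp_sum (T M : finType) (A : cpa_adv ct M) Es (c : T -> R[i])
    (rho : T -> op R M) :
  cpa_amp (A := A) Es (op_sum c rho) = \sum_i c i * cpa_amp Es (rho i).
Proof.
elim: A Es rho => [M' C|M0 M' C A IH] Es rho /=; first exact: one_amp_sum.
under [RHS]eq_bigr do rewrite big_distrr.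
rewrite [RHS]exchange_big; apply: eq_bigr => m _ /=.
by rewrite channel_sum measured_sum tens_sumr IH.
Qed.

Lemma eq_cpa_amp (M : finType) (A : cpa_adv ct M) Es Es' (rho : op R M) :
  (forall j m, Es j m = Es' j m) -> cpa_amp (A := A) Es rho = cpa_amp Es' rho.
Proof.
by move=> e; congr cpa_amp; apply/funext => j; apply/funext => m; exact: e.
Qed.

Definition fcons (n : nat) (T : Type) (t0 : T) (t : {ffun 'I_n -> T}) :
    {ffun 'I_n.+1 -> T} :=
  [ffun j => if unlift ord0 j is Some j' then t j' else t0].

Lemma sum_fcons (n : nat) (T : finType) (C : nmodType)
    (F : {ffun 'I_n.+1 -> T} -> C) :
  \sum_t F t = \sum_t0 \sum_t F (fcons t0 t).
Proof.
rewrite pair_big /=.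
rewrite (reindex (fun p : T * {ffun 'I_n -> T} => fcons p.1 p.2)) //=.
exists (fun t => (t ord0, [ffun j => t (lift ord0 j)])) => [[t0 t]|t] _ /=.
  by congr pair; [|apply/ffunP => j]; rewrite !ffunE ?unlift_none ?liftK.
by apply/ffunP => j; rewrite !ffunE; case: unliftP => [j'|] ->; rewrite ?ffunE.
Qed.

(** The run is linear in each answer, so an index summed afresh at every query may be chosen before
    the run, as a function of the query number. This permits fixing coins and pads in advance. *)
Lemma cpa_amp_oracle_sum (T M : finType) (A : cpa_adv ct M) (c : R[i])
    (F : 'I_(queries A) -> T -> bool -> op R ct) (rho : op R M) :
  cpa_amp (fun j m => op_sum (fun=> c) (fun t => F j t m)) rho =
  c ^+ queries A *
    \sum_(t : {ffun 'I_(queries A) -> T}) cpa_amp (fun j => F j (t j)) rho.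
Proof.
elim: A F rho => [M' C|M0 M' C A IH] F rho /=.
  rewrite expr0 mul1r sumr_const card_ffun card_ord expn0.
  by rewrite mulr1n.
transitivity (\sum_(m : bits bool) \sum_(t : {ffun 'I_(queries A) -> T})
  \sum_t0 c ^+ (queries A).+1 * cpa_amp (A := A) (fun j => F (lift ord0 j) (t j))
    (tens (F ord0 t0 (m b)) (measured m (channel C rho)))).
  apply: eq_bigr => m _.
  rewrite (IH (fun j => F (lift ord0 j))) big_distrr; apply: eq_bigr => t _ /=.
  rewrite tens_suml cpa_amp_sum big_distrr; apply: eq_bigr => t0 _ /=.
  by rewrite exprSr mulrA.
rewrite sum_fcons exchange_big [in RHS]exchange_big /= big_distrr.
apply: eq_bigr => t _ /=; rewrite exchange_big big_distrr.
apply: eq_bigr => t0 _ /=; rewrite big_distrr; apply: eq_bigr => m _ /=.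
congr (_ * cpa_amp _ (tens _ _)); last by rewrite ffunE unlift_none.
by apply/funext => j; rewrite ffunE liftK.
Qed.

End runs.

(** * The reduction *)

Section reduction.
Variables (R : realType) (I X H V : finType) (G : gcircuit X V) (i0 : I).
Let L : finType := {i : I | i != i0}.
Variables (b : bool) (w : (L * X)%type).
Let ct : finType := (I * (H + V))%type.

(** The ciphertext assembled by the reduction: block [i0] is a challenge state,
    and the message enters only through the wire [w]. *)
Definition punctured (u : bits (L * X)%type) (r : bits (I * H)%type)
    (phi : op R V) (m : bool) : op R ct :=
  tens_row (fun i => tens (basis_state R (slot r i))
    (if insub i is Some i' then
       channel G (basis_state R (slot (xor_bit w m u) i'))
     else phi)).

Section assemble.
Variables (n : nat) (M : finType).

(** The ciphertext is put together by renaming wires, without gates: the first challenge state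
    becomes the state of block [i0], the states computed on [L] fill the other blocks, and the
    remaining challenges are renumbered for later queries. *)
Definition assemble
    (z : ((('I_n.+1 * V + M) + L * V) + I * H)%type) : ('I_n * V + (ct + M))%type :=
  match z with
  | inl (inl (inl (j, v))) =>
      if unlift ord0 j is Some j' then inl (j', v) else inr (inl (i0, inr v))
  | inl (inl (inr m)) => inr (inr m)
  | inl (inr (i, v)) => inr (inl (val i, inr v))
  | inr (i, h) => inr (inl (i, inl h))
  end.

Lemma assemble_inj : injective assemble.
Proof.
case=> [[[[j v]|m]|[i v]]|[i h]] [[[[j' v']|m']|[i' v']]|[i' h']] //=;
  try (case: unliftP => [k|] ->); try (case: unliftP => [k'|] ->) => //.
all: try by case=> -> ->.
all: try by case=> ->.
all: try by case.
- by case=> ii; have := valP i'; rewrite /= -ii eqxx.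
- by case=> ii; have := valP i; rewrite /= ii eqxx.
- by case=> /val_inj -> ->.
Qed.

Lemma basis_row (T W : finType) (r x y : bits (T * W)%type) :
  basis_state R r x y = tens_row (fun i => basis_state R (slot r i)) x y.
Proof.
have slotP (z z' : bits (T * W)%type) : (z == z') = [forall i, slot z i == slot z' i].
  apply/eqP/forallP => [-> i|h]; first exact: eqxx.
  by apply/ffunP => -[i v]; have /eqP/ffunP/(_ v) := h i; rewrite !ffunE.
have prodb (P : pred T) : \prod_i (P i)%:R = [forall i, P i]%:R :> R[i].
  have [/forallP h|] := boolP [forall i, P i].
    by rewrite big1 // => i _; rewrite h.
  rewrite negb_forall => /existsP[i /negbTE hi].
  by rewrite (bigD1 i) //= hi mul0r.
rewrite /tens_row /basis_state /ketbra prodb; congr (_%:R); congr nat_of_bool.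
rewrite !slotP; apply/andP/forallP => [[/forallP hx /forallP hy] i|h].
  by rewrite hx hy.
by split; apply/forallP => i; case/andP: (h i).
Qed.

Lemma init_wires_assemble (phi : 'I_n.+1 -> op R V) (mu : op R M)
    (P : L -> op R V) (r : bits (I * H)%type) :
  init_wires assemble
    (tens (tens (tens (tens_row phi) mu) (tens_row P)) (basis_state R r)) =
  tens (tens_row (phi \o lift ord0))
    (tens (tens_row (fun i => tens (basis_state R (slot r i))
       (if insub i is Some i' then P i' else phi ord0))) mu).
Proof.
(* As [assemble] is onto, no wire is initialized and the operator is merely reindexed. *)
have surj z : z \in codom assemble.
  case: z => [[j v]|[[i [h|v]]|m]]; apply/codomP.
  - by exists (inl (inl (inl (lift ord0 j, v)))); rewrite /= liftK.
  - by exists (inr (i, h)).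
  - have [ii|ii] := eqVneq i i0.
      by exists (inl (inl (inl (ord0, v)))); rewrite /= unlift_none ii.
    by exists (inl (inr (exist _ i ii, v))).
  - by exists (inl (inl (inr m))).
have zeroE x : zeros assemble x by apply/forallP => z; rewrite surj.
apply: opP => x y; rewrite init_wiresE !zeroE !mulr1 /tens basis_row /tens_row.
rewrite big_ord_recl [X in _ = _ * (X * _)]big_split /=.
rewrite [X in _ = _ * (_ * X * _)](bigD1 i0) //= insubF ?eqxx //.
pose Q i := if insub i is Some i' then P i' else phi ord0.
have -> (f g : I -> bits V) :
    \prod_(i | i != i0) Q i (f i) (g i) =
    \prod_(i : L) P i (f (val i)) (g (val i)).
  rewrite (big_sub [pred i | i != i0]); apply: eq_bigr => i _.
  by rewrite /Q valK.
have assoc (C : comPzRingType) (a p d e f : C) :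
    a * p * d * e * f = p * (f * (a * e) * d) by ring.
rewrite assoc; congr (_ * (_ * (_ * _) * _)).
- apply: eq_bigr => j _.
  by congr (phi _ _ _); apply/ffunP => v; rewrite !ffunE /= liftK.
- by apply: eq_bigr => i _; congr (basis_state _ _ _ _);
    apply/ffunP => h; rewrite !ffunE.
- by congr (phi _ _ _); apply/ffunP => v; rewrite !ffunE /= unlift_none.
- by apply: eq_bigr => i _; congr (P _ _ _); apply/ffunP => v; rewrite !ffunE.
- by congr (mu _ _); apply/ffunP => m; rewrite !ffunE.
Qed.

End assemble.

Lemma ord0_false : 'I_0 -> False.
Proof. by case. Qed.

Definition drop_empty (M : finType) (z : ('I_0 * V + M)%type) : M :=
  match z with inl p => match ord0_false p.1 with end | inr m => m end.

Lemma drop_empty_inj (M : finType) : injective (@drop_empty M).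
Proof. by move=> [[[]]|m] // [[[]]|m'] //= ->. Qed.

(** Nested prefixes run from the outside in. The inputs of the generator are hard-wired before the
    message is known, and [copy_gate] then adds the message to them. *)
Fixpoint reduction (M : finType) (A : cpa_adv ct M) :
    ('I_(queries A) -> bits (L * X)%type * bits (I * H)%type) ->
    gcircuit ('I_(queries A) * V + M)%type unit :=
  match A in cpa_adv _ M
    return ('I_(queries A) -> bits (L * X)%type * bits (I * H)%type) ->
      gcircuit ('I_(queries A) * V + M)%type unit with
  | Output M C => fun _ => pre_init (@drop_empty_inj M) C
  | Query _ M' C A' => fun p =>
      pre_circuit C
        (pre_basis (p ord0).1
          (pre_gates [:: copy_gate _ _ b w]
            (pre_trace (@keep_inj _ _ _)
              (pre_circuit (row_circuit L G)
                (pre_basis (p ord0).2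
                  (pre_init (@assemble_inj _ M')
                    (reduction (fun j => p (lift ord0 j)))))))))
  end.

(** The equality holds for arbitrary states [phi], so it covers Haar random challenges as well as
    outputs of the generator. *)
Lemma channel_reduction (M : finType) (A : cpa_adv ct M) p
    (phi : 'I_(queries A) -> op R V) (rho : op R M) :
  one_amp (reduction p) (tens (tens_row phi) rho) =
  cpa_amp b (fun j => punctured (p j).1 (p j).2 (phi j)) rho.
Proof.
elim: A p phi rho => [M' C|M0 M' C A IH] p phi rho /=.
  rewrite /one_amp channel_pre_init; congr (channel C _ _ _).
  apply: opP => x y; rewrite init_wiresE.
  have zeroE z : zeros (@drop_empty M') z.
    apply/forallP => m; apply/implyP => /negP[].
    exact: (codom_f _ (inr m : ('I_0 * V + M')%type)).
  rewrite !zeroE !mulr1 /tens /tens_row big_ord0 mul1r.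
  by congr (rho _ _); apply/ffunP => m; rewrite !ffunE.
rewrite /one_amp channel_pre_circuit channel_pre_basis channel_pre_gates.
rewrite channel_pre_trace /= measure_copy.
rewrite channel_sum /op_sum; apply: eq_bigr => m _; rewrite mul1r.
have -> : basis_state R (xor_bit w (m b) (p ord0).1) =
    tens_row (fun i => basis_state R (slot (xor_bit w (m b) (p ord0).1) i)).
  by apply: opP => x y; rewrite basis_row.
rewrite channel_pre_circuit channel_row_circuit channel_pre_basis.
by rewrite channel_pre_init init_wires_assemble -/(one_amp _ _) IH.
Qed.

(** Each query costs six gates per hard-wired bit of inputs and headers, one CNOT and two discarded
    message wires (the 3), and one run of [G] per computed block. *)
Lemma csize_reduction (M : finType) (A : cpa_adv ct M) p :
  (csize (reduction (A := A) p) <= adv_size A + queries A *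
     (6 * (#|I| * #|X|) + 6 * (#|I| * #|H|) + 3 + #|I| * csize G))%N.
Proof.
elim: A p => [M' C|M0 M' C A IH] p /=; first by rewrite csize_pre_init addn0.
apply: leq_trans (csize_pre_circuit _ _) _; rewrite -addnA leq_add2l.
have LI : (#|L| <= #|I|)%N by rewrite card_sig; exact: max_card.
apply: leq_trans (csize_pre_basis _ _) _; rewrite csize_pre_gates csize_pre_trace.
have -> : (#|{: (('I_(queries A).+1 * V + (bool + M')) + L * X)%type}| -
    #|{: (('I_(queries A).+1 * V + M') + L * X)%type}| = 2)%N.
  by rewrite !card_sum card_bool -!addnA subnDl addnK.
have := IH (fun j => p (lift ord0 j)).
move: (reduction _) => D hD.
have h1 := csize_pre_basis (p ord0).2 (pre_init (@assemble_inj _ M') D).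
have := csize_pre_circuit (row_circuit L G)
  (pre_basis (p ord0).2 (pre_init (@assemble_inj _ M') D)).
rewrite csize_row_circuit => h2.
have h3 : csize (pre_init (@assemble_inj _ M') D) = csize D by [].
rewrite {}h3 !card_prod in h1; rewrite card_prod /= [in leqRHS]mulSn.
have h4 : (#|L| * #|X| <= #|I| * #|X|)%N by rewrite leq_mul2r LI orbT.
have h5 : (#|L| * csize G <= #|I| * csize G)%N by rewrite leq_mul2r LI orbT.
move: h1 h2 h4 h5 hD.
move: (_ * (_ + _ + _ + _))%N => q.
move: (csize (pre_circuit _ _)) (csize (pre_basis _ _)) (csize D) (#|L| * csize G)%N
  (#|L| * #|X|)%N (#|I| * #|X|)%N (#|I| * #|H|)%N (#|I| * csize G)%N (adv_size A).
lia.
Qed.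

End reduction.

(** * Positivity and trace *)

Section positivity.
Variable R : realType.

(* The index type is explicit so that the factors of [tens_row] can share it. *)
Definition psd (E W : finType) (rho : op R W) : Prop :=
  exists v : E -> bits W -> R[i], rho = dyads v v.

Lemma psd_gates (E W : finType) (rho : op R W) gs :
  psd E rho -> psd E (foldl (@apply_gate R W) rho gs).
Proof. by move=> [v ->]; exists (gates_vec gs \o v); exact: apply_gates_dyads. Qed.

Lemma psd_init_wires (E I W : finType) (f : I -> W) (rho : op R I) :
  psd E rho -> psd E (init_wires f rho).
Proof.
move=> [v ->]; exists (fun e x => v e (pull f x) * (zeros f x)%:R).
apply: opP => x y; rewrite init_wiresE /dyads !big_distrl.
by apply: eq_bigr => e _ /=; rewrite rmorphM /= conjC_nat; ring.
Qed.

(** The new index records the traced wires. It is a full string whose bits in the range of [f] are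
    normalized to 0, so that each value of the traced wires counts once. *)
Lemma psd_trace_out (E I W : finType) (f : I -> W) (rho : op R W) :
  injective f -> psd E rho -> psd (E * bits W)%type (trace_out f rho).
Proof.
move=> finj [v ->].
exists (fun e x => (pull f e.2 == [ffun=> false])%:R * v e.1 (splice f x e.2)).
apply: opP => x y; rewrite trace_outE // /dyads.
rewrite -(sum_splice_swap finj (fun a => \sum_e v e a * (v e (splice f y a))^*)
  [ffun=> false]).
rewrite exchange_big /= -(pair_bigA _ (fun e c =>
  (pull f c == [ffun=> false])%:R * v e (splice f x c) *
  ((pull f c == [ffun=> false])%:R * v e (splice f y c))^*)) /=.
apply: eq_bigr => e _; rewrite big_mkcond; apply: eq_bigr => c _ /=.
rewrite splice_splice // rmorphM /= conjC_nat.
by case: eqP => _; rewrite ?mul1r // !mul0r.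
Qed.

Lemma psd_channel (E I O : finType) (C : gcircuit I O) (rho : op R I) :
  psd E rho -> psd (E * bits (wires C))%type (channel C rho).
Proof.
move=> prho; apply: psd_trace_out; first exact: outw_inj.
by apply/psd_gates/psd_init_wires.
Qed.

Lemma psd_tens (E F I J : finType) (rho : op R I) (sigma : op R J) :
  psd E rho -> psd F sigma -> psd (E * F)%type (tens rho sigma).
Proof.
move=> [v ->] [u ->]; exists (fun e x => v e.1 (pull inl x) * u e.2 (pull inr x)).
apply: opP => x y; rewrite /tens /dyads big_distrl /=.
rewrite -(pair_bigA _ (fun e f => v e (pull inl x) * u f (pull inr x) *
  (v e (pull inl y) * u f (pull inr y))^*)) /=; apply: eq_bigr => e _.
by rewrite big_distrr; apply: eq_bigr => f _ /=; rewrite rmorphM /=; ring.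
Qed.

Lemma psd_tens_row (E I W : finType) (rho : I -> op R W) :
  (forall i, psd E (rho i)) -> psd {ffun I -> E} (tens_row rho).
Proof.
move=> /choice[v rhoE].
exists (fun (e : {ffun I -> E}) x => \prod_i v i (e i) (slot x i)).
apply: opP => x y; rewrite /tens_row /dyads.
under eq_bigr do rewrite rhoE /dyads.
rewrite bigA_distr_bigA /=; apply: eq_bigr => e _.
by rewrite rmorph_prod -big_split.
Qed.

Lemma psd_basis (W : finType) (u : bits W) : psd unit (basis_state R u).
Proof.
exists (fun _ x => (x == u)%:R); apply: opP => x y.
rewrite /dyads big_const card_unit /= addr0 conjC_nat -natrM mulnb //.
Qed.

Lemma psd_measured (E M : finType) m (sigma : op R (bool + M)%type) :
  psd E sigma -> psd E (measured m sigma).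
Proof. by move=> [v ->]; exists (fun e x => v e (bcat m x)). Qed.

Lemma psd_ge0 (E W : finType) (rho : op R W) x : psd E rho -> 0 <= rho x x.
Proof.
by move=> [v ->]; apply: sumr_ge0 => e _; exact: mul_conjC_ge0.
Qed.

Definition tr (W : finType) (rho : op R W) : R[i] := \sum_x rho x x.

Lemma hadamard_pair (F : comPzRingType) (h a b a' b' : F) : h * h * 2 = 1 ->
  h * (a + (-1) ^+ 0 * b) * (h * (a' + (-1) ^+ 0 * b')) +
  h * (a + (-1) ^+ 1 * b) * (h * (a' + (-1) ^+ 1 * b')) = a * a' + b * b'.
Proof.
move=> hh; transitivity (h * h * 2 * (a * a' + b * b')); first by ring.
by rewrite hh mul1r.
Qed.

Lemma gate_vec_unitary (W : finType) (g : gate W) (v w : bits W -> R[i]) :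
  \sum_x gate_vec v g x * (gate_vec w g x)^* = \sum_x v x * (w x)^*.
Proof.
case: g => [u|u|c t ct].
- have flipK := xor_bitK u true.
  (* A Hadamard gate mixes each string with its flip at [u]; doubling the sum makes these pairs
     visible. *)
  have dbl (F : bits W -> R[i]) :
      2 * \sum_x F x = \sum_x (F x + F (xor_bit u true x)).
    rewrite big_split /= [X in _ + X](reindex_inj (inv_inj flipK)) /=.
    under [X in _ + X]eq_bigr do rewrite flipK.
    by rewrite mulr_natl mulr2n.
  apply: (@mulfI _ 2); first by rewrite pnatr_eq0.
  rewrite !dbl; apply: eq_bigr => x _; rewrite !hadamard_vec.
  have st p : setbit u p (xor_bit u true x) = setbit u p x.
    by apply/ffunP => k; rewrite !ffunE; case: eqP.
  rewrite !st; have -> : xor_bit u true x = setbit u (~~ x u) x.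
    by apply/ffunP => k; rewrite !ffunE; case: eqP => [->|]; rewrite ?addbT.
  have -> z : v x * z = v (setbit u (x u) x) * z.
    by congr (v _ * _); apply/ffunP => k; rewrite !ffunE; case: eqP => [->|].
  have -> : w x = w (setbit u (x u) x).
    by congr w; apply/ffunP => k; rewrite !ffunE; case: eqP => [->|].
  rewrite !ffunE eqxx; move: (x u) => xu.
  rewrite !rmorphM !rmorphD !rmorphM !rmorph_sign /=.
  have hc : ((real_complex R (Num.sqrt 2)^-1)^* = real_complex R (Num.sqrt 2)^-1)%R.
    by apply/conj_Creal/ger0_real; rewrite lecR invr_ge0 sqrtr_ge0.
  rewrite !hc; move: (real_complex R _) (half_sqrt2 R) => h hh.
  case: xu => /=; last exact (hadamard_pair _ _ _ _ hh).
  rewrite addrC [RHS]addrC. 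
  exact (hadamard_pair _ _ _ _ hh).
- apply: eq_bigr => x _; rewrite !tgate_vec rmorphM /=.
  case: ifP => _; last by rewrite conjC1 !mul1r.
  rewrite mulrACA -[RHS]mul1r; congr (_ * _).
  apply/eqP; rewrite eq_complex /=.
  have ss : (Num.sqrt 2)^-1 * (Num.sqrt 2)^-1 = 2^-1 :> R.
    by rewrite -expr2 exprVn sqr_sqrtr.
  by apply/andP; split; apply/eqP; rewrite ?mulrN ?ss; lra.
- have vE (z : bits W -> R[i]) x : gate_vec z (CNOT ct) x = z (xor_bit t (x c) x).
    rewrite /gate_vec (bigD1 (xor_bit t (x c) x)) //= big1 => [|a /negbTE ax].
      by rewrite -/(gate_coef R (CNOT ct) _ _) cnot_coef eqxx mul1r addr0.
    by rewrite -/(gate_coef R (CNOT ct) _ _) cnot_coef ax mul0r.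
  under eq_bigr do rewrite !vE.
  have inv : involutive (fun x : bits W => xor_bit t (x c) x).
    by move=> x; apply/ffunP => k; rewrite !ffunE (negbTE ct); case: eqP; rewrite ?addbK.
  by rewrite [RHS](reindex_inj (inv_inj inv)).
Qed.

(** The trace of a dyad is an inner product, which a unitary gate preserves. *)
Lemma tr_gates (W : finType) (rho : op R W) gs :
  tr (foldl (@apply_gate R W) rho gs) = tr rho.
Proof.
rewrite (op_dyads rho) apply_gates_dyads /tr /dyads exchange_big.
rewrite [RHS]exchange_big; apply: eq_bigr => e _ /=.
rewrite /gates_vec; elim/last_ind: gs => [|gs g IH] //=.
by rewrite !foldl_rcons gate_vec_unitary IH.
Qed.

Lemma tr_init_wires (I W : finType) (f : I -> W) (rho : op R I) :
  injective f -> tr (init_wires f rho) = tr rho.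
Proof.
move=> finj; rewrite /tr.
transitivity (\sum_x rho (pull f x) (pull f x) * (agree f [ffun=> false] x)%:R).
  apply: eq_bigr => x _; rewrite init_wiresE -mulrA -natrM mulnb andbb.
  congr (_ * _%:R); congr nat_of_bool; apply: eq_forallb => w.
  by rewrite ffunE; case: (x w).
by rewrite sum_agree //; apply: eq_bigr => x _; rewrite pull_splice.
Qed.

Lemma tr_trace_out (O W : finType) (f : O -> W) (rho : op R W) :
  injective f -> tr (trace_out f rho) = tr rho.
Proof.
move=> finj; rewrite /tr [RHS](partition_big (pull f) predT) //=.
apply: eq_bigr => x _; rewrite trace_outE //; apply: eq_bigr => a /eqP <-.
by rewrite splice_pull // agree_refl.
Qed.

Lemma tr_channel (I O : finType) (C : gcircuit I O) (rho : op R I) :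
  tr (channel C rho) = tr rho.
Proof.
by rewrite /channel tr_trace_out ?tr_gates ?tr_init_wires //;
  [exact: inw_inj|exact: outw_inj].
Qed.

Lemma sum_bcat (I J : finType) (F : bits (I + J)%type -> R[i]) :
  \sum_z F z = \sum_x \sum_y F (bcat x y).
Proof.
rewrite pair_big /= (reindex (fun p : bits I * bits J => bcat p.1 p.2)) //=.
exists (fun z => (pull inl z, pull inr z)) => [[x y]|z] _ /=.
  by rewrite pull_bcatl pull_bcatr.
by rewrite bcat_pull.
Qed.

Lemma tr_tens (I J : finType) (rho : op R I) (sigma : op R J) :
  tr (tens rho sigma) = tr rho * tr sigma.
Proof.
rewrite /tr sum_bcat big_distrl; apply: eq_bigr => x _ /=.
rewrite big_distrr; apply: eq_bigr => y _ /=.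
by rewrite /tens pull_bcatl pull_bcatr.
Qed.

Lemma tr_tens_row (I W : finType) (rho : I -> op R W) :
  tr (tens_row rho) = \prod_i tr (rho i).
Proof.
rewrite /tr bigA_distr_bigA /=.
rewrite (reindex (fun h : {ffun I -> bits W} =>
  [ffun p => h p.1 p.2] : bits (I * W)%type)) /=.
  apply: eq_bigr => h _; apply: eq_bigr => i _.
  by congr (rho i _ _); apply/ffunP => w; rewrite !ffunE.
exists (fun a : bits (I * W)%type => [ffun i => slot a i]) => [h|a] _.
  by apply/ffunP => i; apply/ffunP => w; rewrite !ffunE.
by apply/ffunP => -[i w]; rewrite !ffunE.
Qed.

Lemma tr_basis (W : finType) (u : bits W) : tr (basis_state R u) = 1.
Proof.
rewrite /tr (bigD1 u) //= /basis_state /ketbra eqxx big1 ?addr0 // => x.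
by move=> /negbTE ->.
Qed.

Lemma tr_measured (M : finType) (sigma : op R (bool + M)%type) :
  \sum_m tr (measured m sigma) = tr sigma.
Proof. by rewrite /tr sum_bcat. Qed.

Lemma one_amp_bounds (E I : finType) (C : gcircuit I unit) (rho : op R I) :
  psd E rho -> 0 <= one_amp C rho <= tr rho.
Proof.
move=> /(psd_channel C) prho; rewrite /one_amp (psd_ge0 _ prho) /=.
rewrite -(tr_channel C) /tr (bigD1 [ffun=> true]) //= lerDl.
by apply: sumr_ge0 => x _; exact: psd_ge0 prho.
Qed.

(** The bound is a trace instead of 1 because measured states are unnormalized; the traces over all
    outcomes add up to the trace before the measurement. *)
Lemma cpa_amp_bounds (ct M : finType) (b : bool) (A : cpa_adv ct M) (Ec : finType) Es
    (E : finType) (rho : op R M) :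
  (forall j m, psd Ec (Es j m) /\ tr (Es j m) = 1) -> psd E rho ->
  0 <= cpa_amp b (A := A) Es rho <= tr rho.
Proof.
move=> hEs.
elim: A E rho Es hEs => [M' C|M0 M' C A IH] E rho Es hEs prho /=.
  exact: one_amp_bounds prho.
have h (m : bits bool) := IH _ _ (fun j => Es (lift ord0 j)) (fun j => hEs _)
  (psd_tens (hEs ord0 (m b)).1 (psd_measured m (psd_channel C prho))).
rewrite sumr_ge0 => [/=|m _]; last by case/andP: (h m).
rewrite -(tr_channel C) -tr_measured; apply: ler_sum => m _.
by case/andP: (h m) => _; rewrite tr_tens (hEs _ _).2 mul1r.
Qed.

End positivity.

(** * Switching the inputs of a pseudorandom function-like state *)

Lemma poly_boundedD f g : poly_bounded f -> poly_bounded g ->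
  poly_bounded (fun l => f l + g l)%N.
Proof. by move=> [p fp] [r gr]; exists (p + r) => l; rewrite hornerD leq_add. Qed.

Lemma poly_boundedM f g : poly_bounded f -> poly_bounded g ->
  poly_bounded (fun l => f l * g l)%N.
Proof. by move=> [p fp] [r gr]; exists (p * r) => l; rewrite hornerM leq_mul. Qed.

Lemma poly_bounded_cst k : poly_bounded (fun=> k).
Proof. by exists k%:P => l; rewrite hornerC. Qed.

Lemma poly_bounded_id : poly_bounded id.
Proof. by exists 'X => l; rewrite hornerX. Qed.

Lemma poly_bounded_le f g : (forall l, (f l <= g l)%N) -> poly_bounded g ->
  poly_bounded f.
Proof. by move=> fg [p gp]; exists p => l; exact: leq_trans (gp l). Qed.

Section switch.
Variables (R : realType) (mu : forall m : nat, probability (qvec R m) R).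
Variables (d n : nat -> nat).
Variable G : forall l, gcircuit ('I_l + 'I_(d l))%type 'I_(n l).
Hypothesis Gsec : selectively_secure_prfs mu G.

Definition oblivious (d n s t : nat)
    (A : gcircuit ('I_s * ('I_d + 'I_t * 'I_n))%type unit) : Prop :=
  forall x x' (rho : 'I_s -> op R 'I_n),
    accept A (prfs_view x rho) = accept A (prfs_view x' rho).

(** Everything to be chosen at one [l], packed so that a family can be built by choice. The
    successor in [sw_A_le] leaves room for the single wire of the default instance. *)
Record switch_inst (q B : nat -> nat) (l : nat) := SwitchInst {
  sw_s : nat;
  sw_s_le : (sw_s <= q l)%N;
  sw_A : gcircuit ('I_sw_s * ('I_(d l) + 'I_1 * 'I_(n l)))%type unit;
  sw_A_le : (csize sw_A <= (B l).+1)%N;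
  sw_x : 'I_sw_s -> bits 'I_(d l);
  sw_x' : 'I_sw_s -> bits 'I_(d l);
  sw_x_inj : injective sw_x;
  sw_x'_inj : injective sw_x' }.

Arguments sw_x {q B l} _ _.
Arguments sw_x' {q B l} _ _.
Arguments sw_x_inj {q B l} _.
Arguments sw_x'_inj {q B l} _.

Lemma switch_inst0 q B l : switch_inst q B l.
Proof.
have no (p : ('I_0 * ('I_(d l) + 'I_1 * 'I_(n l)))%type) : unit by exact: tt.
have noI : injective no by move=> [[]].
pose x0 (i : 'I_0) : bits 'I_(d l) := [ffun=> false].
have x0I : injective x0 by case.
apply: (@SwitchInst q B l 0 (leq0n _)
  (@GCircuit _ unit unit no id noI (fun _ _ => id) [::]) _ x0 x0 x0I x0I).
by rewrite /csize card_unit.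
Qed.

(** The threshold [l0] is uniform over circuits and inputs, whereas security gives one per family. A
    family that picks a violating instance at every [l] having one is itself an admissible
    adversary, as circuits are non-uniform. *)
Lemma prfs_switch (q B : nat -> nat) : poly_bounded q -> poly_bounded B ->
  forall c, exists l0, forall l, (l0 <= l)%N -> forall s, (s <= q l)%N ->
  forall A : gcircuit ('I_s * ('I_(d l) + 'I_1 * 'I_(n l)))%type unit,
  (csize A <= B l)%N -> oblivious A ->
  forall x x' : 'I_s -> bits 'I_(d l), injective x -> injective x' ->
  `|prfs_real R (G l) x A - prfs_real R (G l) x' A| <= l%:R ^- c :> R.
Proof.
move=> qpoly Bpoly c.
pose bad l (i : switch_inst q B l) := oblivious (sw_A i) /\
  ~~ (`|prfs_real R (G l) (sw_x i) (sw_A i) - prfs_real R (G l) (sw_x' i) (sw_A i)|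
      <= l%:R ^- c :> R).
(* The family must be admissible for every [l], so it takes an empty instance
   wherever there is no bad one. *)
have worst l : exists i : switch_inst q B l, (exists j, bad l j) -> bad l i.
  have [[j jbad]|nobad] := pselect (exists j, bad l j); first by exists j.
  by exists (switch_inst0 q B l) => /nobad.
pose i l := sval (cid (worst l)).
have iP l : (exists j, bad l j) -> bad l (i l) := svalP (cid (worst l)).
have spoly : poly_bounded (fun l => sw_s (i l)).
  by apply: poly_bounded_le qpoly => l; exact: sw_s_le.
have Apoly : qpt (fun l => sw_A (i l)).
  apply: (poly_bounded_le (g := fun l => B l + 1)%N).
    by move=> l; rewrite addn1; exact: sw_A_le.
  exact: poly_boundedD (poly_bounded_cst 1).
have [_ sec] := Gsec.
have {}sec := sec _ _ spoly (poly_bounded_cst 1) _ Apoly.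
(* With exponent [c.+1], two errors add up to at most l^-c once l >= 2. *)
have [l1 h1] := sec _ (fun l => sw_x_inj (i l)) c.+1.
have [l2 h2] := sec _ (fun l => sw_x'_inj (i l)) c.+1.
exists (maxn 2 (maxn l1 l2)) => l; rewrite !geq_max => /and3P[l_2 l_1 l_l2].
move=> s sq A AB obl x x' xI x'I; apply: contrapT => /negP far.
have AB' : (csize A <= (B l).+1)%N by exact: ltnW.
have [oblA /negP[]] : bad l (i l).
  by apply: iP; exists (SwitchInst sq AB' xI x'I).
have := h1 l l_1; have := h2 l l_l2.
(* The ideal terms agree for each sample of states by obliviousness, and cancel. *)
have -> : prfs_ideal (mu (n l)) (sw_x' (i l)) (sw_A (i l)) =
          prfs_ideal (mu (n l)) (sw_x (i l)) (sw_A (i l)).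
  by congr (Rintegral _ _ _); apply/funext => psi; exact: oblA.
move: (prfs_real _ _ _ _) (prfs_real _ _ _ _) (prfs_ideal _ _ _) => u v z hv hu.
have -> : u - v = (u - z) - (v - z) by ring.
apply: le_trans (ler_normB _ _) _; apply: le_trans (lerD hu hv) _.
have l0 : 0 < l%:R :> R by rewrite ltr0n; exact: leq_trans l_2.
rewrite exprS invfM -mulr2n -[leLHS]mulr_natl mulrA.
rewrite ler_piMl ?invr_ge0 ?exprn_ge0 ?(ltW l0) //.
by rewrite ler_pdivrMr // mul1r ler_nat.
Qed.

End switch.

(** * Games *)

Lemma xor_bit0 (W : finType) (w : W) x : xor_bit w false x = x.
Proof. by apply/ffunP => k; rewrite !ffunE addbF; case: eqP. Qed.

Lemma parity_xor_bit l (i : 'I_l) p s : parity (xor_bit i p s) = parity s (+) p.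
Proof.
rewrite /parity (bigD1 i) //= [in RHS](bigD1 i) //= ffunE eqxx -!addbA.
rewrite [p (+) _]addbC; congr (_ (+) (_ (+) _)).
by apply: eq_bigr => j /negbTE ji; rewrite ffunE ji.
Qed.

Lemma sum_xor_bit (W : finType) (w : W) p (C : nmodType) (F : bits W -> C) :
  \sum_x F x = \sum_x F (xor_bit w p x).
Proof. exact: reindex_inj (inv_inj (@xor_bitK _ w p)). Qed.

Definition set_parity l (i : 'I_l) (m : bool) (s : bits 'I_l) : bits 'I_l :=
  xor_bit i (parity s (+) m) s.

(** Correcting the bit [i] is a two-to-one map onto the strings of parity [m]. *)
Lemma sum_set_parity l (i : 'I_l) m (C : nmodType) (F : bits 'I_l -> C) :
  \sum_s F (set_parity i m s) = (\sum_(s | parity s == m) F s) *+ 2.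
Proof.
rewrite (bigID (fun s => parity s == m)) /= mulr2n; congr (_ + _).
  by apply: eq_bigr => s /eqP sm; rewrite /set_parity sm addbb xor_bit0.
rewrite (reindex_inj (inv_inj (@xor_bitK _ i true))) /=; apply: eq_big => s.
  by rewrite parity_xor_bit; case: (parity s); case: m.
rewrite /set_parity parity_xor_bit addbT => sm.
have -> : ~~ parity s (+) m = true by move: sm; case: (parity s); case: m.
by rewrite xor_bitK.
Qed.

Lemma avg_set_parity l (i : 'I_l) m (R : numFieldType) (F : bits 'I_l -> R) :
  #|[set s : bits 'I_l | parity s == m]|%:R^-1 *
    \sum_(s : bits 'I_l | parity s == m) F s =
  #|bits 'I_l|%:R^-1 * \sum_s F (set_parity i m s).
Proof.
rewrite sum_set_parity.
have -> : #|bits 'I_l| = (#|[set s : bits 'I_l | parity s == m]| * 2)%N.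
  rewrite -sum1dep_card -sum1_card muln2 -addnn.
  exact (sum_set_parity i m (fun=> 1%N)).
have halve (a f : R) : a * f = a * 2^-1 * (f *+ 2) by rewrite mulr2n; field.
by rewrite natrM invfM halve.
Qed.

Section avg.
Variable R : realFieldType.

Definition avg (T : finType) (F : T -> R) : R := #|T|%:R^-1 * \sum_x F x.

Lemma avg_dist (T : finType) (F F' : T -> R) e : 0 <= e ->
  (forall x, `|F x - F' x| <= e) -> `|avg F - avg F'| <= e.
Proof.
move=> e0 h; rewrite /avg -mulrBr -sumrB normrM ger0_norm ?invr_ge0 ?ler0n //.
have [T0|] := posnP #|T|; first by rewrite T0 invr0 mul0r.
rewrite -(ltr0n R) => T0; rewrite ler_pdivrMl // mulr_natl.
apply: le_trans (ler_norm_sum _ _ _) _; apply: le_trans (ler_sum _ (fun x _ => h x)) _.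
by rewrite sumr_const.
Qed.

Lemma avg_bounds (T : finType) (F : T -> R) :
  (forall x, 0 <= F x <= 1) -> 0 <= avg F <= 1.
Proof.
move=> h; rewrite /avg mulr_ge0 ?invr_ge0 ?ler0n ?sumr_ge0 //=; last first.
  by move=> x _; case/andP: (h x).
have [T0|] := posnP #|T|; first by rewrite T0 invr0 mul0r ler01.
rewrite -(ltr0n R) => T0; rewrite ler_pdivrMl // mulr1 -sum1_card natr_sum.
by apply: ler_sum => x _; case/andP: (h x).
Qed.

Lemma eq_avg (T : finType) (F F' : T -> R) : F =1 F' -> avg F = avg F'.
Proof. by move=> h; rewrite /avg (eq_bigr _ (fun x _ => h x)). Qed.

Lemma avg_exchange (T U : finType) (F : T -> U -> R) :
  avg (fun x => avg (F x)) = avg (fun y => avg (F^~ y)).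
Proof.
rewrite /avg -!big_distrr /= exchange_big mulrCA; congr (_ * (_ * _)).
Qed.

Definition set_coord (I T : finType) (i : I) (x : T) (f : {ffun I -> T}) :
    {ffun I -> T} :=
  [ffun j => if j == i then x else f j].

(** Exchanging the new value with the old coordinate is an involution on pairs (f, x). It isolates
    the key of one block from the others. *)
Lemma avg_resample (I T : finType) (i : I) (F : {ffun I -> T} -> R) :
  (0 < #|T|)%N -> avg F = avg (fun f => avg (fun x => F (set_coord i x f))).
Proof.
move=> T0; rewrite /avg; congr (_ * _); rewrite -big_distrr /=.
have T0' : #|T|%:R != 0 :> R by rewrite pnatr_eq0 -lt0n.
apply: (mulfI T0'); rewrite mulVKf // mulr_natl -sumrMnl.
pose swap (p : {ffun I -> T} * T) := (set_coord i p.2 p.1, p.1 i).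
have swapK : involutive swap.
  move=> [f x]; congr pair; last by rewrite ffunE eqxx.
  by apply/ffunP => j; rewrite !ffunE; case: eqP => [->|].
transitivity (\sum_(f : {ffun I -> T}) \sum_(x : T) F f).
  by apply: eq_bigr => f _; rewrite sumr_const.
by rewrite !pair_big [RHS](reindex_inj (inv_inj swapK)) /=; apply: eq_bigr => p _;
  congr F; rewrite -[in LHS](swapK p).
Qed.

End avg.

(** * The CPA game with fixed coins *)

Section game.
Variables (R : realType) (l d n : nat) (G : gcircuit ('I_l + 'I_d)%type 'I_n).
Let key : finType := {ffun 'I_l -> bits 'I_l}.
Let coins : finType := {ffun 'I_l -> bits 'I_d.-1}.
Let ct : finType := ('I_l * ('I_d.-1 + 'I_n))%type.
Implicit Types (sk : key) (r : coins) (s : bits 'I_l).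

Definition blocks sk r s : op R ct :=
  tens_row (fun i =>
    tens (basis_state R (r i)) (prfs_eval R G (sk i) (bsnoc (r i) (s i)))).

Definition enc_coins sk r (m : bool) : op R ct := fun x y =>
  #|[set s : bits 'I_l | parity s == m]|%:R^-1 *
  \sum_(s : bits 'I_l | parity s == m) blocks sk r s x y.

Lemma prfs_encE sk m :
  prfs_enc R G sk m = op_sum (fun=> #|coins|%:R^-1) (fun r => enc_coins sk r m).
Proof.
apply: opP => x y; rewrite /prfs_enc /op_sum /enc_coins exchange_big /=.
rewrite big_distrr /=; apply: eq_bigr => r _; ring.
Qed.

Lemma enc_coinsE (i : 'I_l) sk r m :
  enc_coins sk r m =
  op_sum (fun=> #|bits 'I_l|%:R^-1) (fun s => blocks sk r (set_parity i m s)).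
Proof.
apply: opP => x y.
rewrite /enc_coins (avg_set_parity i m (fun s => blocks sk r s x y)).
by rewrite /op_sum big_distrr.
Qed.

Variable A : cpa_adv ct void.
Let Q := queries A.
Let rho0 : op R void := basis_state R [ffun=> false].
Implicit Types (t : {ffun 'I_Q -> coins}) (S : {ffun 'I_Q -> bits 'I_l}).

Definition coins_game b t : R :=
  avg (fun sk : key => complex.Re (cpa_amp b (A := A) (fun j => enc_coins sk (t j)) rho0)).

Lemma Re_invnat k (z : R[i]) :
  complex.Re (k%:R^-1 * z) = k%:R^-1 * complex.Re z.
Proof.
have -> : k%:R^-1 = real_complex R k%:R^-1 by rewrite fmorphV rmorph_nat.
by case: z => a c /=; rewrite mul0r subr0.
Qed.

Lemma Re_invnatX k e (z : R[i]) :
  complex.Re (k%:R^-1 ^+ e * z) = k%:R^-1 ^+ e * complex.Re z.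
Proof. by rewrite !exprVn -!natrX Re_invnat. Qed.

Lemma cpa_game_coins Test b :
  cpa_game (S := ske_of_prfs R G Test) A b =
  avg (coins_game b).
Proof.
rewrite /coins_game avg_exchange /cpa_game /= /prfs_gen -big_distrr.
apply: eq_avg => sk /=; rewrite (cpa_runE b (fun m => prfs_enc R G sk m)).
rewrite (_ : (fun=> _) = (fun (_ : 'I_Q) m =>
    op_sum (fun=> #|coins|%:R^-1) (fun r => enc_coins sk r m))); last first.
  by apply/funext => j; apply/funext => m; exact: prfs_encE.
rewrite cpa_amp_oracle_sum Re_invnatX raddf_sum /avg [in RHS]card_ffun card_ord.
by rewrite natrX exprVn.
Qed.

Lemma coins_gameE (i : 'I_l) b t :
  coins_game b t = avg (fun sk : key => avg (fun S : {ffun 'I_Q -> bits 'I_l} =>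
    complex.Re (cpa_amp b (A := A)
      (fun j m => blocks sk (t j) (set_parity i m (S j))) rho0))).
Proof.
apply: eq_avg => sk; rewrite (_ : (fun j => enc_coins sk (t j)) = (fun j m =>
    op_sum (fun=> #|bits 'I_l|%:R^-1)
      (fun s => blocks sk (t j) (set_parity i m s)))); last first.
  by apply/funext => j; apply/funext => m; exact: enc_coinsE.
rewrite (cpa_amp_oracle_sum b _ (fun j s m => blocks sk (t j) (set_parity i m s))).
by rewrite Re_invnatX raddf_sum /avg [in RHS]card_ffun card_ord natrX exprVn.
Qed.

(** Serves for coins that collide at every index, where the advantage is bounded trivially. *)
Lemma coins_game_bounds (i : 'I_l) b t : 0 <= coins_game b t <= 1.
Proof.
rewrite (coins_gameE i); apply: avg_bounds => sk; apply: avg_bounds => S.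
set z := cpa_amp _ _ _.
have : 0 <= z <= tr rho0.
  apply: (@cpa_amp_bounds _ _ _ _ _ {ffun 'I_l -> unit * (unit * bits (wires G))}
    _ _ _ _ (psd_basis _ _)) => j m; split.
    apply: psd_tens_row => k.
    exact: psd_tens (psd_basis _ _) (psd_channel _ (psd_basis _ _)).
  rewrite tr_tens_row big1 // => k _.
  by rewrite tr_tens tr_channel !tr_basis mulr1.
rewrite tr_basis.
by case: z => a c; rewrite !lecE /= => /andP[/andP[_ ->] /andP[_ ->]].
Qed.

(** * Coins without collision at one index *)

Section good.
Variables (i0 i1 : 'I_l).
Hypothesis i10 : i1 != i0.
Hypothesis d0 : (0 < d)%N.
Let L : finType := {i : 'I_l | i != i0}.

Lemma last_subproof : (d.-1 < d)%N. Proof. by rewrite prednK. Qed.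

(** The last input bit of block [i1], which carries s_i1. *)
Definition msg_wire : (L * ('I_l + 'I_d))%type :=
  (exist _ i1 i10, inr (Ordinal last_subproof)).

Definition inputs sk r s (m : bool) : bits (L * ('I_l + 'I_d))%type :=
  [ffun p => bcat (sk (val p.1))
    (bsnoc (r (val p.1)) (set_parity i1 m s (val p.1))) p.2].

(** The message enters [set_parity] only as a summand of bit [i1], so it may be added after the
    strings for message 0 are prepared. *)
Lemma xor_inputs sk r s m :
  xor_bit msg_wire m (inputs sk r s false) = inputs sk r s m.
Proof.
apply/ffunP => -[i z]; rewrite !ffunE xpair_eqE -val_eqE /=.
case: z => [k|h] /=; first by rewrite andbF.
case: eqP => [->|_] //=; rewrite addbF !ffunE; case: insubP => [h' hlt _|hge].
  by case: eqP => // -[hE]; move: hlt; rewrite hE ltnn.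
case: eqP => [_|[]]; first by rewrite addbA.
congr inr; apply: val_inj => /=; apply/eqP.
by rewrite eqn_leq -ltnS prednK // ltn_ord leqNgt hge.
Qed.

(** Flipping s_i0 changes the total parity and hence the correction at [i1]; s_i0 itself is not
    among these inputs. *)
Lemma inputs_xor_bit sk r s m :
  inputs sk r s m = inputs sk r (xor_bit i0 m s) false.
Proof.
apply/ffunP => -[i z]; rewrite [LHS]ffunE [RHS]ffunE /=.
congr (bcat _ (bsnoc _ _) _); rewrite !ffunE parity_xor_bit addbF.
by have := valP i; rewrite /= => /negbTE ->.
Qed.

Lemma inputs_set_coord sk r s m k :
  inputs (set_coord i0 k sk) r s m = inputs sk r s m.
Proof.
apply/ffunP => -[i z]; rewrite [LHS]ffunE [RHS]ffunE /=.
have -> : set_coord i0 k sk (val i) = sk (val i).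
  by rewrite ffunE; have := valP i; rewrite /= => /negbTE ->.
by [].
Qed.

Definition flat_coins r : bits ('I_l * 'I_d.-1)%type := [ffun p => r p.1 p.2].

Lemma blocks_punctured sk r s m :
  blocks sk r (set_parity i1 m s) =
  punctured G msg_wire (inputs sk r s false) (flat_coins r)
    (prfs_eval R G (sk i0) (bsnoc (r i0) (s i0))) m.
Proof.
congr tens_row; apply/funext => i; congr tens.
  by congr basis_state; apply/ffunP => h; rewrite !ffunE.
rewrite xor_inputs; case: insubP => [i' ii' i'i|]; last first.
  rewrite negbK => /eqP ->; congr (prfs_eval _ _ _ (bsnoc _ _)).
  by rewrite ffunE eq_sym (negbTE i10).
congr (channel _ (basis_state _ _)); apply/ffunP => z.
by rewrite pullE [RHS]ffunE /= (i'i : sval i' = i).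
Qed.

Lemma punctured_inputs sk r s (phi : op R 'I_n) m :
  punctured G msg_wire (inputs sk r s false) (flat_coins r) phi m =
  punctured G msg_wire (inputs sk r (xor_bit i0 m s) false) (flat_coins r) phi false.
Proof. by rewrite /punctured !xor_inputs -inputs_xor_bit. Qed.

Variable t : {ffun 'I_Q -> coins}.

Definition query_params sk S (j : 'I_Q) :=
  (inputs sk (t j) (S j) false, flat_coins (t j)).

(** Only the single copy of the state is kept. The accompanying input string is traced out, which
    makes the distinguisher oblivious. *)
Definition read_wire (v : 'I_n) : ('I_d + 'I_1 * 'I_n)%type := inr (ord0, v).

Lemma read_wire_inj : injective read_wire.
Proof. by move=> v v' []. Qed.

Definition distinguisher b sk S :
    gcircuit ('I_Q * ('I_d + 'I_1 * 'I_n))%type unit :=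
  pre_trace (idp_inj (L := 'I_Q) read_wire_inj) (pre_init (@inl_inj _ _)
    (reduction G b msg_wire (query_params sk S))).

Lemma trace_out_view (x : 'I_Q -> bits 'I_d) (phi : 'I_Q -> op R 'I_n) :
  trace_out (idp read_wire) (prfs_view x phi) = tens_row phi.
Proof.
rewrite trace_out_idp; last exact: read_wire_inj.
congr tens_row; apply/funext => j; apply: opP => a c.
have fI := read_wire_inj.
pose put e : bits ('I_d + 'I_1 * 'I_n)%type := bcat (x j) [ffun p => e p.2].
have putE e v : put e (read_wire v) = e v by rewrite ffunE /= ffunE.
have splE (z : bits ('I_d + 'I_1 * 'I_n)%type) e :
    splice read_wire e z = bcat (pull inl z) [ffun p => e p.2].
  apply/ffunP => -[h|[k v]]; last first.
    rewrite ord1; transitivity (e v); last by rewrite ffunE /= ffunE.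
    exact: (splice_in fI e z v).
  by rewrite splice_notin ?ffunE ?ffunE //; apply/codomP => -[].
rewrite trace_outE // (bigD1 (put a)) /=; last first.
  by apply/eqP/ffunP => v; rewrite pullE putE.
rewrite big1 ?addr0 => [|z /andP[/eqP za zput]].
  rewrite /tens splE !pull_bcatl !pull_bcatr /basis_state /ketbra eqxx mul1r.
  rewrite /tens_row big_ord1; congr (phi j _ _); apply/ffunP => v; by rewrite !ffunE.
rewrite /tens /basis_state /ketbra; case: eqP => [zx|]; last by rewrite mul0r.
case/eqP: zput; rewrite -[z]bcat_pull zx; congr bcat; apply/ffunP => -[k v].
by rewrite ord1 !ffunE -za ffunE.
Qed.

Lemma accept_distinguisher b sk S x (phi : 'I_Q -> op R 'I_n) :
  accept (distinguisher b sk S) (prfs_view x phi) =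
  complex.Re (cpa_amp b (A := A) (fun j => punctured G msg_wire
    (inputs sk (t j) (S j) false) (flat_coins (t j)) (phi j)) rho0).
Proof.
transitivity (complex.Re (one_amp (reduction G b msg_wire (query_params sk S))
    (tens (tens_row phi) rho0))); last by rewrite channel_reduction.
rewrite /accept /one_amp channel_pre_trace trace_out_view channel_pre_init.
congr (complex.Re (channel _ _ _ _)).
apply: opP => a c; rewrite init_wiresE /tens.
have zeroE (z : bits ('I_Q * 'I_n + void)%type) : zeros inl z.
  by apply/forallP => -[p|[]]; rewrite codom_f.
have void1 (z z' : bits void) : z = z' by apply/ffunP => -[].
rewrite !zeroE !mulr1 /rho0 /basis_state /ketbra.
by rewrite (void1 (pull inr a) [ffun=> false]) (void1 (pull inr c) [ffun=> false]) eqxx mulr1.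
Qed.

Lemma csize_distinguisher b sk S :
  (csize (distinguisher b sk S) <= adv_size A + Q *
     (6 * (l * (l + d)) + 6 * (l * d.-1) + 3 + l * csize G) + Q * d)%N.
Proof.
rewrite csize_pre_trace csize_pre_init.
rewrite !card_prod card_sum card_prod !card_ord mul1n mulnDr addnK leq_add2r.
have := csize_reduction G b msg_wire (query_params sk S).
by rewrite card_sum !card_ord.
Qed.

(** [x] replaces the generator's input at [i0] only, while the pads still determine the correction
    at [i1]. It may depend on the pads but not on the keys, as selective security requires. *)
Definition hybrid b (x : {ffun 'I_Q -> bits 'I_l} -> 'I_Q -> bits 'I_d) : R :=
  avg (fun sk : key => avg (fun S : {ffun 'I_Q -> bits 'I_l} =>
    complex.Re (cpa_amp b (A := A) (fun j => punctured G msg_wire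
      (inputs sk (t j) (S j) false) (flat_coins (t j))
      (prfs_eval R G (sk i0) (x S j))) rho0))).

(** No other part of the experiment involves the key of [i0], so resampling it alone produces the
    average inside [prfs_real]. *)
Lemma hybridE b x :
  hybrid b x =
  avg (fun S => avg (fun sk : key => prfs_real R G (x S) (distinguisher b sk S))).
Proof.
rewrite /hybrid avg_exchange; apply: eq_avg => S.
rewrite (avg_resample i0) ?card_ffun ?expn_gt0 ?card_bool //.
apply: eq_avg => sk; apply: eq_avg => k.
have skk : set_coord i0 k sk i0 = k by rewrite ffunE eqxx.
rewrite skk -(accept_distinguisher _ _ _ (x S)); congr (accept _ _).
rewrite /distinguisher /query_params.
by congr (pre_trace _ (pre_init _ (reduction _ _ _ _)));
  apply/funext => j; rewrite inputs_set_coord.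
Qed.

Definition real_inputs S (j : 'I_Q) := bsnoc (t j i0) (S j i0).

Definition zero_inputs S (j : 'I_Q) := bsnoc (t j i0) false.

Lemma coins_game_hybrid b : coins_game b t = hybrid b real_inputs.
Proof.
rewrite (coins_gameE i1); apply: eq_avg => sk; apply: eq_avg => S.
by congr (complex.Re _); apply: eq_cpa_amp => j m; rewrite blocks_punctured.
Qed.

(** The bit [b] only selects which message reaches the oracle. *)
Lemma cpa_amp_const (M : finType) (B : cpa_adv ct M) (E : 'I_(queries B) -> op R ct) rho :
  cpa_amp false (A := B) (fun j _ => E j) rho = cpa_amp true (fun j _ => E j) rho.
Proof.
elim: B E rho => [M' C|M0 M' C B IH] E rho //=.
by apply: eq_bigr => m _; rewrite (IH (fun j => E (lift ord0 j))).
Qed.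

(* Flipping [s_{i0}] flips the bit xored into the message at [i1] and changes
   nothing else. *)
Lemma hybrid_zero : hybrid false zero_inputs = hybrid true zero_inputs.
Proof.
apply: eq_avg => sk.
pose c : R[i] := #|bits 'I_l|%:R^-1.
pose F (j : 'I_Q) s m : op R ct := punctured G msg_wire (inputs sk (t j) s false)
  (flat_coins (t j)) (prfs_eval R G (sk i0) (bsnoc (t j i0) false)) m.
(* Only after averaging over the pad does the answer cease to depend on the message. *)
pose O (j : 'I_Q) : op R ct := op_sum (fun=> c) (fun s => F j s false).
have OE : (fun (j : 'I_Q) (_ : bool) => O j) =
    (fun j m => op_sum (fun=> c) (fun s => F j s m)).
  apply/funext => j; apply/funext => m; apply: opP => x y.
  apply: etrans (sum_xor_bit i0 m (fun s => c * F j s false x y)) _.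
  by apply: eq_bigr => s _; rewrite /F (punctured_inputs _ _ s _ m).
have avgE b : avg (fun S : {ffun 'I_Q -> bits 'I_l} =>
      complex.Re (cpa_amp b (A := A) (fun j => F j (S j)) rho0)) =
    complex.Re (cpa_amp b (A := A) (fun j _ => O j) rho0).
  rewrite OE (cpa_amp_oracle_sum b c F).
  rewrite Re_invnatX raddf_sum /avg [in LHS]card_ffun card_ord.
  by rewrite natrX exprVn.
transitivity (complex.Re (cpa_amp false (A := A) (fun j _ => O j) rho0)).
  exact: avgE.
rewrite cpa_amp_const.
exact/esym/avgE.
Qed.

(** One switch of inputs in each of the two games gives [e + e]. Distinct coins stay distinct inputs
    whatever bit is appended, so both ends of a switch are injective. *)
Lemma good_coins (e : R) : 0 <= e -> injective (fun j => t j i0) ->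
  (forall b sk S x x', injective x -> injective x' ->
    `|prfs_real R G x (distinguisher b sk S) -
      prfs_real R G x' (distinguisher b sk S)| <= e) ->
  `|coins_game false t - coins_game true t| <= e + e.
Proof.
move=> e0 tI he.
have bsnocI (r r' : bits 'I_d.-1) p p' : bsnoc r p = bsnoc r' p' :> bits 'I_d -> r = r'.
  move=> /ffunP rr; apply/ffunP => h; have := rr (widen_ord (leq_pred d) h).
  by rewrite !ffunE /= valK.
have xI S : injective (real_inputs S) by move=> j j' /bsnocI; exact: tI.
have x'I S : injective (zero_inputs S) by move=> j j' /bsnocI; exact: tI.
have close b : `|coins_game b t - hybrid b zero_inputs| <= e.
  rewrite coins_game_hybrid !hybridE; apply: avg_dist => // S.
  by apply: avg_dist => // sk; exact: he.
rewrite -(subrKA (hybrid false zero_inputs)) {2}hybrid_zero.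
apply: le_trans (ler_normD _ _) _; rewrite lerD //.
by rewrite distrC; exact: close.
Qed.

End good.
End game.

(** * Collisions among the coins *)

(** The birthday bound N^_k / N^k >= 1 - k^2 / (2N), with denominators cleared. *)
Lemma leq_expn_ffact N k :
  (2 * N * N ^ k <= 2 * N * N ^_ k + k ^ 2 * N ^ k)%N.
Proof.
elim: k => [|k IH]; first by rewrite !expn0 ffactn0 leq_addr.
have ff : (N ^_ k <= N ^ k)%N.
  elim: k {IH} => [|k IH]; first by rewrite ffactn0.
  by rewrite ffactnSr expnSr leq_mul // leq_subr.
rewrite ffactnSr expnS.
(* The induction may lose 2k + 1 = (k + 1)^2 - k^2. For k > N the falling factorial at k already
   vanishes. *)
have step : (N * (2 * N * N ^_ k) <=
    2 * N * (N ^_ k * (N - k)) + (2 * k + 1) * (N * N ^ k))%N.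
  have [kN|Nk] := leqP k N; last by rewrite ffact_small // !muln0.
  have -> : (N * (2 * N * N ^_ k) =
      2 * N * (N ^_ k * (N - k)) + 2 * k * (N * N ^_ k))%N.
    move: (N ^_ k) (subnK kN) => F; move: (N - k)%N => m <-; ring.
  rewrite leq_add2l leq_mul ?leq_addr // leq_mul //.
have := leq_mul (leqnn N) IH.
move: step; move: (N ^_ k * (N - k))%N (N ^ k)%N (N ^_ k) => u v w.
nia.
Qed.

Lemma birthday N k : (k ^ 2 <= N)%N -> (N ^ k <= 2 * N ^_ k)%N.
Proof.
move=> kN; have [N0|N0] := posnP N.
  by move: kN; rewrite N0; case: k.
rewrite -(leq_pmul2l N0) -(leq_add2r (N * N ^ k)).
have := leq_expn_ffact N k; rewrite -[(2 * N * N ^ k)%N]mulnA.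
rewrite -[(2 * N * N ^_ k)%N]mulnA [(N * (2 * _))%N]mulnCA.
have : (k ^ 2 * N ^ k <= N * N ^ k)%N by rewrite leq_mul2r kN orbT.
move: (N * N ^ k)%N (k ^ 2 * N ^ k)%N (N * N ^_ k)%N => u v w. lia.
Qed.

Definition colliding (k : nat) (I T : finType) (t : {ffun 'I_k -> {ffun I -> T}}) :=
  [forall i, ~~ injectiveb [ffun j => t j i]].

(** Transposing [t] turns it into one independent column per index, each failing to be injective
    with probability at most 1/2. *)
Lemma card_colliding (k : nat) (I T : finType) : (k ^ 2 <= #|T|)%N ->
  (#|[pred t : {ffun 'I_k -> {ffun I -> T}} | colliding t]| * 2 ^ #|I| <=
   #|{ffun 'I_k -> {ffun I -> T}}|)%N.
Proof.
move=> kT.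
pose N : pred {ffun 'I_k -> T} := fun f => ~~ injectiveb f.
have NE : (#|N| * 2 <= #|T| ^ k)%N.
  have inj : #|[pred f : {ffun 'I_k -> T} | injectiveb f]| = (#|T| ^_ k)%N.
    by rewrite -[k in RHS]card_ord -card_inj_ffuns cardsE; exact: eq_card.
  have := cardC [pred f : {ffun 'I_k -> T} | injectiveb f].
  rewrite inj card_ffun card_ord.
  have -> : #|[predC [pred f : {ffun 'I_k -> T} | injectiveb f]]| = #|N|.
    exact: eq_card.
  by have := birthday kT; move: (#|T| ^ k)%N (#|T| ^_ k) #|N| => u v w; lia.
pose tr (t : {ffun 'I_k -> {ffun I -> T}}) : {ffun I -> {ffun 'I_k -> T}} :=
  [ffun i => [ffun j => t j i]].
have trI : injective tr.
  move=> t t' /ffunP e; apply/ffunP => j; apply/ffunP => i.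
  by have /ffunP/(_ j) := e i; rewrite !ffunE.
have le : (#|[pred t : {ffun 'I_k -> {ffun I -> T}} | colliding t]| <=
    #|ffun_on N : pred {ffun I -> _}|)%N.
  rewrite -[leqLHS](fintype.card_image trI); apply: subset_leq_card.
  apply/fintype.subsetP => f /fintype.imageP[t].
  move=> /forallP ct ->; apply/ffun_onP => i; rewrite ffunE; exact: ct.
apply: leq_trans (leq_mul le (leqnn _)) _.
rewrite card_ffun_on -expnMn.
have -> : #|{ffun 'I_k -> {ffun I -> T}}| = ((#|T| ^ k) ^ #|I|)%N.
  by rewrite !card_ffun card_ord -!expnM mulnC.
by case: #|I| => [|e]; rewrite ?expn0 // leq_exp2r // mulnC.
Qed.

(** With m = l / k rounded down, l^k <= ((m + 1) k)^k <= (2^m)^k <= 2^l. The middle inequality holds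
    for m >= 3k, hence the threshold 3k^2. *)
Lemma expn_le_exp2 k : exists l0, forall l, (l0 <= l)%N -> (l ^ k <= 2 ^ l)%N.
Proof.
have [->|k0] := posnP k; first by exists 0%N => l _; rewrite expn0 expn_gt0.
have lin m : (3 * k <= m)%N -> (m.+1 * k <= 2 ^ m)%N.
  move=> /subnK <-; elim: (m - 3 * k)%N => [|j IH]; rewrite ?add0n.
    have -> : (2 ^ (3 * k) = 2 ^ k * 2 ^ k * 2 ^ k)%N.
      by rewrite -!expnD !mulSn mul0n addn0 addnA.
    have ku : (k < 2 ^ k)%N by exact: ltn_expl.
    apply: leq_trans (leq_mul (leq_mul ku ku) ku).
    by have := leq0n (k * k * k); nia.
  rewrite addSn expnS; apply: leq_trans (leq_mul (leqnn 2) IH).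
  by move: (j + _)%N => u; nia.
exists (3 * k * k)%N => l hl.
apply: leq_trans (_ : ((l %/ k).+1 * k) ^ k <= _)%N.
  by rewrite leq_exp2r // ltnW // ltn_ceil.
apply: leq_trans (_ : (2 ^ (l %/ k)) ^ k <= _)%N.
  by rewrite leq_exp2r // lin // leq_divRL.
by rewrite -expnM leq_exp2l // leq_trunc_div.
Qed.

Lemma leq_sqr_exp2 (R : realType) (q d : nat) :
  2 * (ln q%:R / ln 2) + 1 <= d%:R :> R ->
  (0 < d)%N /\ (q ^ 2 <= 2 ^ d.-1)%N.
Proof.
have ln2 : 0 < ln 2 :> R by apply: ln_gt0; rewrite ltr1n.
move=> h.
have d0 : (0 < d)%N.
  rewrite -(ltr0n R); apply: lt_le_trans h; rewrite ltr_wpDl //.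
  rewrite mulr_ge0 // divr_ge0 ?(ltW ln2) //.
  (* At q = 0 the convention ln 0 = 0 applies. *)
  have [->|q0] := posnP q; first by rewrite ln0 ?lexx.
  by apply: ln_ge0; rewrite ler1n.
split=> //; have [->|q0] := posnP q; first by [].
rewrite -(ler_nat R) !natrX -ler_ln ?posrE ?exprn_gt0 ?ltr0n //.
rewrite !lnXn ?ltr0n // -[leLHS]mulr_natl -[leRHS]mulr_natl.
have dE : d%:R = d.-1%:R + 1 :> R by rewrite natr1 prednK.
by move: h; rewrite dE lerD2r mulrA ler_pdivrMr.
Qed.

(** The term 2^-l pays for coins colliding at every index; [e + e] bounds the advantage on all other
    coins. *)
Lemma cpa_advantage (R : realType) (l d n : nat)
    (G : gcircuit ('I_l + 'I_d)%type 'I_n)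
    (Test : gcircuit ('I_l + 'I_d + 'I_n)%type unit)
    (A : cpa_adv ('I_l * ('I_d.-1 + 'I_n))%type void) (e : R) :
  (1 < l)%N -> (0 < d)%N -> (queries A ^ 2 <= 2 ^ d.-1)%N -> 0 <= e ->
  (forall D : gcircuit ('I_(queries A) * ('I_d + 'I_1 * 'I_n))%type unit,
    (csize D <= adv_size A + queries A *
       (6 * (l * (l + d)) + 6 * (l * d.-1) + 3 + l * csize G) +
       queries A * d)%N ->
    oblivious R D ->
    forall x x' : 'I_(queries A) -> bits 'I_d, injective x -> injective x' ->
    `|prfs_real R G x D - prfs_real R G x' D| <= e) ->
  `|cpa_game (S := ske_of_prfs R G Test) A false -
    cpa_game (S := ske_of_prfs R G Test) A true| <= 2%:R ^- l + (e + e).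
Proof.
move=> l1 d0 Qd e0 he; rewrite !cpa_game_coins.
have [j0 [j1 j10]] : exists j0 j1 : 'I_l, j1 != j0.
  by exists (Ordinal (ltnW l1)), (Ordinal l1).
pose T : finType := {ffun 'I_(queries A) -> {ffun 'I_l -> bits 'I_d.-1}}.
have close (t : T) : `|coins_game R G false t - coins_game R G true t| <=
    (colliding t)%:R + (e + e) :> R.
  have [ct|] := boolP (colliding t).
    apply: le_trans (_ : 1 <= _); last by rewrite lerDl addr_ge0.
    have /andP[f0 f1] := coins_game_bounds R G j0 false t.
    have /andP[t0 t1] := coins_game_bounds R G j0 true t.
    rewrite ler_norml; lra.
  rewrite negb_forall add0r => /existsP[i0]; rewrite negbK => /injectiveP tI.
  (* The index [i0] depends on the coins, so two indices are kept at hand to find another one. *)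
  have [i1 i10] : exists i1, i1 != i0.
    by have [<-|ne] := eqVneq j0 i0; [exists j1|exists j0].
  apply: (good_coins (i10 := i10) (d0 := d0) e0).
    by move=> j j' jj; apply: tI; rewrite !ffunE.
  move=> b sk S x x' xI x'I; apply: he xI x'I; first exact: csize_distinguisher.
  by move=> y y' rho; rewrite !accept_distinguisher.
have T0 : 0 < #|T|%:R :> R.
  by rewrite ltr0n; apply/card_gt0P; exists [ffun=> [ffun=> [ffun=> false]]].
rewrite /avg -mulrBr -sumrB normrM ger0_norm ?invr_ge0 ?ler0n //.
rewrite ler_pdivrMl //; apply: le_trans (ler_norm_sum _ _ _) _.
apply: le_trans (ler_sum _ (fun t _ => close t)) _.
rewrite big_split /= sumr_const mulrDr [X in _ <= _ + X]mulr_natl lerD2r.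
have : (#|[pred t : T | colliding t]| * 2 ^ #|'I_l| <= #|T|)%N.
  by apply: card_colliding; rewrite card_ffun card_bool card_ord.
rewrite card_ord -(ler_nat R) natrM natrX ler_pdivlMr ?exprn_gt0 // => h.
apply: le_trans h; rewrite ler_wpM2r ?exprn_ge0 //.
rewrite -natr_sum ler_nat -sum1_card [leqRHS]big_mkcond /=.
by apply: leq_sum => t _; rewrite inE; case: (colliding t).
Qed.

Theorem theorem3p30 (R : realType)
    (mu : forall m : nat, probability (qvec R m) R)
    (mu_haar : forall m : nat, is_haar (mu m))
    (q : nat -> nat) (d : nat -> nat -> nat) (n : nat -> nat)
    (G : forall l q0 : nat, gcircuit ('I_l + 'I_(d l q0))%type 'I_(n l))
    (Test : forall l q0 : nat,
       gcircuit ('I_l + 'I_(d l q0) + 'I_(n l))%type unit) :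
  poly_bounded q ->
  (forall l : nat,
     2 * (ln (q l)%:R / ln 2) + 1 <= (d l (q l))%:R :> R) ->
  selectively_secure_prfs mu (fun l => G l (q l)) ->
  cpa_secure (fun l q0 => ske_of_prfs R (G l q0) (Test l q0)) q.
Proof.
move=> qpoly qd Gsec A Aq Apoly c.
pose g l := csize (G l (q l)).
have gpoly : poly_bounded g := Gsec.1.
(* Every input of the generator is a wire, so [g l] bounds l + d and stands for it here. *)
pose B l := (adv_size (A l) +
  q l * (6 * (l * g l) + 6 * (l * g l) + 3 + l * g l) + q l * g l)%N.
have Bpoly : poly_bounded B.
  have lg := poly_boundedM poly_bounded_id gpoly.
  have lg6 := poly_boundedM (poly_bounded_cst 6) lg.
  apply: poly_boundedD (poly_boundedM qpoly gpoly).
  apply: poly_boundedD Apoly (poly_boundedM qpoly _).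
  apply: poly_boundedD lg.
  exact: poly_boundedD (poly_boundedD lg6 lg6) (poly_bounded_cst 3).
have [l1 h1] := prfs_switch Gsec qpoly Bpoly c.+1.
have [l2 h2] := expn_le_exp2 c.+1.
(* One error from collisions and two from switches give 3 l^-(c+1), which is at most l^-c for l >=
   3. *)
exists (maxn 3 (maxn l1 l2)) => l; rewrite !geq_max => /and3P[l_3 l_1 l_2].
have [d0 q2d] := leq_sqr_exp2 (qd l).
have ldg : (l + d l (q l) <= g l)%N.
  apply: leq_trans (_ : #|wires (G l (q l))| <= _)%N; last exact: leq_addr.
  by have := leq_card _ (@inw_inj _ _ (G l (q l))); rewrite card_sum !card_ord.
have l0 : 0 < l%:R :> R by rewrite ltr0n; exact: leq_trans l_3.
set e : R := l%:R ^- c.+1.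
have e0 : 0 <= e by rewrite invr_ge0 exprn_ge0 ?ltW.
apply: le_trans (@cpa_advantage R l _ (n l) (G l (q l)) (Test l (q l)) (A l) e
  _ d0 _ e0 _) _.
- exact: leq_trans l_3.
- by apply: leq_trans q2d; rewrite leq_exp2r //; exact: Aq.
- move=> D sD oD x x' xI x'I; apply: h1 => //; first exact: Aq.
  apply: leq_trans sD _; rewrite /B.
  have dg : (d l (q l) <= g l)%N by exact: leq_trans (leq_addl _ _) ldg.
  apply: leq_add; last exact: leq_mul (Aq l) dg.
  rewrite leq_add2l; apply: leq_mul (Aq l) _; rewrite !leq_add2r.
  apply: leq_add; rewrite !leq_mul2l ?ldg ?orbT //=.
  by rewrite (leq_trans (leq_pred _) dg) orbT.
- have : 2%:R ^- l <= e.
    rewrite lef_pV2 ?posrE ?exprn_gt0 // -!natrX ler_nat; exact: h2.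
  move=> e2; apply: le_trans (lerD e2 (lexx _)) _.
  have -> : e + (e + e) = 3 / l%:R * l%:R ^- c.
    by rewrite /e exprS invfM; ring.
  rewrite ler_piMl ?invr_ge0 ?exprn_ge0 ?(ltW l0) //.
  by rewrite ler_pdivrMr // mul1r ler_nat.
Qed.
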